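(* Let $L,d$ be positive integers and $\mu_0,t_0,J>0$, and let $\mu_\infty(u)$, $u\in\mathbb{R}^{L^d}$, be the probability measures defined in the context, with densities $\mu_\infty(u,\cdot)$. Then the function $\mathcal{S}:\mathbb{R}^{L^d}\to\mathbb{R}$, $$\mathcal{S}[u]=\int_{\mathbb{R}}\log|\lambda|\,\mu_\infty(u,\lambda)\,d\lambda-\frac{\|u\|^2}{2J^2L^d},$$ is concave.
   Context: $\Delta\in\mathbb{R}^{L^d\times L^d}$ is the periodic lattice Laplacian on $\{1,\dots,L\}^d$, $(\Delta f)(x)=\sum_{i=1}^d(f(x+e_i)+f(x-e_i)-2f(x))$. (In the paper $J=2\sqrt{B''(0)}$, with $B$ the noise correlator, $B''(0)>0$.) For $u\in\mathbb{R}^{L^d}$ let $a(u)=-t_0\Delta+\mathrm{diag}(u)+\mu_0\mathrm{Id}$. For $z$ with $\mathrm{Im}\,z>0$, let $m_\infty(u,z)\in\mathbb{C}^{L^d}$ (identified with a diagonal matrix) be the unique solution of $$m_\infty(u,z)=\mathrm{diag}\big[(a(u)-J^2m_\infty(u,z)-z\,\mathrm{Id})^{-1}\big],\qquad\mathrm{Im}\,m_\infty(u,z)>0\text{ componentwise},$$ where $\mathrm{diag}[T]$ keeps only the diagonal of $T$. $\mu_\infty(u)$ is the probability measure with $\int\frac{\mu_\infty(u,ds)}{s-z}=\frac{1}{L^d}\sum_{i=1}^{L^d}m_\infty(u,z)_i$; it has a bounded, compactly supported density $\mu_\infty(u,\cdot)$. *)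

(* Defs.v *)
From mathcomp Require Import all_boot all_order all_algebra.
From mathcomp Require Import all_classical all_reals all_analysis.
From mathcomp Require Import complex.
Import Order.TTheory GRing.Theory Num.Theory.
Import numFieldNormedType.Exports.

Set Implicit Arguments.
Unset Strict Implicit.
Unset Printing Implicit Defensive.

Local Open Scope classical_set_scope.
Local Open Scope ring_scope.

(* The discrete torus (Z/LZ)^d. Vectors and matrices are indexed by ordinals
   below its cardinal, which stand for sites through enum_val. *)
Definition site (L d : nat) : finType := {ffun 'I_d -> 'I_L}.

Definition nsites (L d : nat) : nat := #|site L d|.

Lemma nsitesE (L d : nat) : nsites L d = (L ^ d)%N.
Proof. by rewrite /nsites card_ffun !card_ord. Qed.

(* x + e_k and x - e_k; ordS and ord_pred wrap around modulo L. *)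
Definition site_succ (L d : nat) (k : 'I_d) (x : site L d) : site L d :=
  [ffun j => if j == k then ordS (x j) else x j].

Definition site_pred (L d : nat) (k : 'I_d) (x : site L d) : site L d :=
  [ffun j => if j == k then ord_pred (x j) else x j].

Definition laplacian (R : realType) (L d : nat) (f : site L d -> R)
    (x : site L d) : R :=
  \sum_(k < d) (f (site_succ k x) + f (site_pred k x) - 2 * f x).

(* Column j is the image under the Laplacian of the indicator of site j. *)
Definition laplacian_mx (R : realType) (L d : nat) : 'M[R]_(nsites L d) :=
  \matrix_(i, j) laplacian (fun y => (y == enum_val j)%:R) (enum_val i).

Definition a_mx (R : realType) (L d : nat) (t0 mu0 : R)
    (u : 'rV[R]_(nsites L d)) : 'M[R]_(nsites L d) :=
  - (t0 *: laplacian_mx R L d) + diag_mx u + mu0%:M.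

Definition diag_part (F : pzRingType) (n : nat) (T : 'M[F]_n) : 'M[F]_n :=
  diag_mx (\row_i T i i).

(* invmx is a genuine inverse here: the conditions 0 < Im z and 0 < Im m
   make the matrix to be inverted nonsingular. *)
Definition dyson_solution (R : realType) (L d : nat) (t0 mu0 J : R)
    (u : 'rV[R]_(nsites L d)) (z : R[i]) (m : 'rV[R[i]]_(nsites L d)) : Prop :=
  diag_mx m =
    diag_part (invmx (map_mx (real_complex R) (a_mx t0 mu0 u)
                      - real_complex R (J ^+ 2) *: diag_mx m - z%:M))
  /\ forall i, 0 < complex.Im (m ord0 i).

Definition stieltjes (R : realType) (mu : probability (measurableTypeR R) R)
    (z : R[i]) : R[i] :=
  let f (s : R) : R[i] := (real_complex R s - z)^-1 in
  Complex (\int[mu]_s complex.Re (f s)) (\int[mu]_s complex.Im (f s)).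

Definition bounded_compact_density (R : realType)
    (mu : probability (measurableTypeR R) R) (rho : R -> R) : Prop :=
  [/\ measurable_fun setT rho,
      forall x, 0 <= rho x,
      exists M : R, forall x, rho x <= M,
      compact (closure [set x | rho x != 0]) &
      forall A : set (measurableTypeR R), measurable A ->
        mu A = (\int[lebesgue_measure]_(x in A) (rho x)%:E)%E].

Definition functional_S (R : realType) (L d : nat) (J : R)
    (rho : 'rV[R]_(nsites L d) -> R -> R) (u : 'rV[R]_(nsites L d)) : R :=
  \int[lebesgue_measure]_x (ln `|x| * rho u x)
  - (\sum_i u ord0 i ^+ 2) / (2 * J ^+ 2 * (L ^ d)%:R).

Definition concave_function (R : realType) (V : lmodType R) (f : V -> R)
    : Prop :=
  forall (x y : V) (t : R), 0 <= t -> t <= 1 ->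
    t * f x + (1 - t) * f y <= f (t *: x + (1 - t) *: y).

(* Main.v *)
Require Import Defs.
From mathcomp Require Import all_boot all_order all_algebra.
From mathcomp Require Import all_classical all_reals all_analysis.
From mathcomp Require Import complex.
From mathcomp Require Import measurable_realfun ring lra.
Import Order.TTheory GRing.Theory Num.Theory.
Import numFieldNormedType.Exports.

(** Fix the real symmetric matrix [H = - t0 Delta + mu0 Id], put [z = i eta] and
[f = u - z], and let [w = f - J^2 m] be the effective complex diagonal and
[G(w) = (H + diag w)^-1].  The Dyson equation reads [m_i = G(w)_ii].  It is the
stationarity condition in [m] of the action

  [Phi = log |det (H + diag w)| + J^2/2 Re sum_i m_i^2],

so that the differential of [Phi] along a variation [df] of [f] is just
[Re sum_i m_i df_i] ([is_derive_action]).  Two consequences.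

In the variable [eta], the derivative of [Phi] is [sum_i Im m_i], which the
Stieltjes transform identifies with the derivative of [N] times the smoothed
logarithmic potential [int 1/2 log (s^2 + eta^2) mu_u(ds)].  Both quantities
are [N log eta + O(1/eta)] at infinity, hence they are equal for all [eta > 0]
([log_potentialE]).

In the variable [u], the gradient of [Phi - |u|^2 / (2 J^2)] is
[Re m - u / J^2 = - Re w / J^2], so concavity amounts to monotonicity of
[u |-> Re w(u)].  For two solutions, the resolvent identity and the symmetry of
[G] give [du_i = dw_i - J^2 sum_j G_ij G'_ij dw_j], while taking the imaginary
part of the Dyson equation gives [J^2 sum_j |G_ij|^2 v_j <= v_i] for the
positive vector [v = - Im w].  By a Schur test the matrix [J^2 |G_ij G'_ij|] has
norm at most [1], whence [sum_i du_i Re dw_i >= 0] ([dyson_monotone]).  At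
positive height the norm is bounded away from [1], which also makes [w] a
Lipschitz function of [f] ([dyson_lipschitz]); this is the only regularity of
[m] needed to differentiate [Phi], because [Phi] is stationary in [m].

Finally [eta -> 0]: since the density is bounded with compact support and
[log |x|] is locally integrable, dominated convergence turns the smoothed
potentials into [int log |x| rho_u(x) dx] ([log_potential_cvg]), and concavity
passes to pointwise limits. *)

Set Implicit Arguments.
Unset Strict Implicit.
Unset Printing Implicit Defensive.
Local Open Scope classical_set_scope.
Local Open Scope ring_scope.

Local Notation Re := complex.Re.
Local Notation Im := complex.Im.
Local Notation normc := ComplexField.Normc.normc.
Local Notation "x %:C" := (real_complex _ x) (at level 1, format "x %:C") : ring_scope.

(** * Complex numbers *)

Section ComplexNumbers.
Context {R : rcfType}.
Implicit Types (x y z : R[i]).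

Lemma ReD x y : Re (x + y) = Re x + Re y.
Proof. by case: x; case: y. Qed.

Lemma ImD x y : Im (x + y) = Im x + Im y.
Proof. by case: x; case: y. Qed.

Lemma ReN x : Re (- x) = - Re x.
Proof. by case: x. Qed.

Lemma ImN x : Im (- x) = - Im x.
Proof. by case: x. Qed.

Lemma ReB x y : Re (x - y) = Re x - Re y.
Proof. by rewrite ReD ReN. Qed.

Lemma ImB x y : Im (x - y) = Im x - Im y.
Proof. by rewrite ImD ImN. Qed.

Lemma ReM x y : Re (x * y) = Re x * Re y - Im x * Im y.
Proof. by case: x; case: y. Qed.

Lemma ImM x y : Im (x * y) = Re x * Im y + Im x * Re y.
Proof. by case: x; case: y. Qed.

Lemma ReMr (a : R) x : Re (a%:C * x) = a * Re x.
Proof. by rewrite ReM /= mul0r subr0. Qed.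

Lemma ImMr (a : R) x : Im (a%:C * x) = a * Im x.
Proof. by rewrite ImM /= mul0r addr0. Qed.

Lemma Re_sum I (r : seq I) (P : pred I) (F : I -> R[i]) :
  Re (\sum_(i <- r | P i) F i) = \sum_(i <- r | P i) Re (F i).
Proof. exact: (big_morph _ ReD). Qed.

Lemma Im_sum I (r : seq I) (P : pred I) (F : I -> R[i]) :
  Im (\sum_(i <- r | P i) F i) = \sum_(i <- r | P i) Im (F i).
Proof. exact: (big_morph _ ImD). Qed.

Lemma normc_ge0 x : 0 <= normc x.
Proof. by case: x => a b; exact: sqrtr_ge0. Qed.

Lemma normrE x : `|x| = (normc x)%:C.
Proof. by case: x. Qed.

Lemma sqr_normcE x : normc x ^+ 2 = Re x ^+ 2 + Im x ^+ 2.
Proof. by case: x => a b; rewrite sqr_sqrtr// addr_ge0 ?sqr_ge0. Qed.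

Lemma normcD x y : normc (x + y) <= normc x + normc y.
Proof. exact: le_normcD. Qed.

Lemma normcM x y : normc (x * y) = normc x * normc y.
Proof. exact: ComplexField.Normc.normcM. Qed.

Lemma normcN x : normc (- x) = normc x.
Proof. exact: normcN. Qed.

Lemma normc_conjc x : normc (conjc x) = normc x.
Proof. by case: x => a b /=; rewrite sqrrN. Qed.

Lemma normc_real (a : R) : normc a%:C = `|a|.
Proof. by rewrite /= expr0n /= addr0 sqrtr_sqr. Qed.

Lemma normc_sum I (r : seq I) (P : pred I) (F : I -> R[i]) :
  normc (\sum_(i <- r | P i) F i) <= \sum_(i <- r | P i) normc (F i).
Proof.
elim/big_ind2: _ => [|x a y b xa yb|//]; first by rewrite normc_real normr0.
exact: (le_trans (normcD _ _) (lerD xa yb)).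
Qed.

Lemma ler_Re_normc x : `|Re x| <= normc x.
Proof. by case: x => a b /=; rewrite -sqrtr_sqr ler_wsqrtr// lerDl sqr_ge0. Qed.

Lemma ler_Im_normc x : `|Im x| <= normc x.
Proof. by case: x => a b /=; rewrite -sqrtr_sqr ler_wsqrtr// lerDr sqr_ge0. Qed.

Lemma normc_gt0 x : (0 < normc x) = (x != 0).
Proof. by rewrite -ltcR -normrE normr_gt0. Qed.

Lemma mulc_conjc x : x * conjc x = (normc x ^+ 2)%:C.
Proof. by rewrite -sqr_normc normrE rmorphXn. Qed.

Lemma normc_prod I (r : seq I) (P : pred I) (F : I -> R[i]) :
  normc (\prod_(i <- r | P i) F i) = \prod_(i <- r | P i) normc (F i).
Proof.
by apply: (big_morph _ normcM); rewrite normc_real normr1.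
Qed.

Lemma normcV x : normc x^-1 = (normc x)^-1.
Proof. exact: ComplexField.Normc.normcV. Qed.
End ComplexNumbers.

(** * Resolvents of a real symmetric matrix with complex diagonal *)

Section Resolvent.
Context {R : rcfType} {n : nat}.
Variable (H : 'M[R]_n).
Hypothesis symH : H^T = H.
Implicit Types w : 'rV[R[i]]_n.

Definition shifted (w : 'rV[R[i]]_n) : 'M[R[i]]_n :=
  map_mx (real_complex R) H + diag_mx w.

Definition green (w : 'rV[R[i]]_n) : 'M[R[i]]_n := invmx (shifted w).

Local Notation adj A := (map_mx (@conjc R) A)^T.

Lemma tr_shifted w : (shifted w)^T = shifted w.
Proof. by rewrite /shifted linearD /= tr_diag_mx map_trmx symH. Qed.

Lemma green_sym w i j : green w i j = green w j i.
Proof. by rewrite -[in LHS](trmxK (green w)) mxE trmx_inv tr_shifted. Qed.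

Lemma adj_shifted w : adj (shifted w) = shifted (map_mx (@conjc R) w).
Proof.
rewrite map_trmx tr_shifted /shifted map_mxD map_diag_mx; congr (_ + _).
by apply/matrixP => i j; rewrite !mxE; exact: conjc_real.
Qed.

(** A real symmetric matrix is Hermitian, so its quadratic form is real even on
complex vectors. *)
Lemma im_quadratic_form (v : 'rV[R[i]]_n) :
  Im ((v *m map_mx (real_complex R) H *m adj v) 0 0) = 0.
Proof.
set Q := v *m _ *m _.
suff : conjc (Q 0 0) = Q 0 0.
  by case: (Q 0 0) => a b /= [] /eqP; rewrite eqNr => /eqP.
have -> : conjc (Q 0 0) = (adj Q) 0 0 by rewrite !mxE.
suff -> : adj Q = Q by []; rewrite /Q !map_mxM !trmx_mul -map_trmx trmxK.
rewrite -mulmxA; apply: (congr2 mulmx).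
  by apply/matrixP => i j; rewrite !mxE; exact: conjcK.
apply: (congr2 mulmx) => //.
rewrite -[in RHS]symH; apply/matrixP => i j; rewrite !mxE.
exact: conjc_real.
Qed.

(** On a null vector [v], the imaginary part of the form of [H + diag w] is
[sum_i Im w_i |v_i|^2], which vanishes only if [v = 0]. *)
Lemma shifted_unit w : (forall i, Im (w 0 i) < 0) -> shifted w \in unitmx.
Proof.
move=> w_lt0; rewrite -row_free_unit -kermx_eq0; apply/negPn/negP => ker_n0.
set v := nz_row (kermx (shifted w)).
have vn0 : v != 0 by rewrite nz_row_eq0.
have /sub_kermxP vB0 : (v <= kermx (shifted w))%MS by exact: nz_row_sub.
have : Im ((v *m shifted w *m adj v) 0 0) = 0 by rewrite vB0 mul0mx mxE.
rewrite /shifted mulmxDr mulmxDl mxE ImD im_quadratic_form add0r mul_mx_diag.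
rewrite mxE Im_sum => sum0.
have vi0 i : normc (v 0 i) = 0.
  apply/eqP; rewrite eq_le normc_ge0 andbT leNgt; apply/negP => vi_gt0.
  suff : \sum_(i < n) - Im ((\matrix_(i0, j) (v i0 j * w 0 j)) 0 i * adj v i 0) > 0.
    by rewrite sumrN sum0 oppr0 ltxx.
  have termE j : - Im ((\matrix_(i0, j) (v i0 j * w 0 j)) 0 j * adj v j 0) =
      - Im (w 0 j) * normc (v 0 j) ^+ 2.
    by rewrite !mxE mulrAC mulc_conjc ImMr mulNr mulrC.
  rewrite (bigD1 i) //= termE ltr_pwDl //.
    by rewrite mulr_gt0 ?oppr_gt0 ?exprn_gt0.
  by apply: sumr_ge0 => j _; rewrite termE mulr_ge0 ?sqr_ge0 ?oppr_ge0 ?ltW.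
move/eqP: vn0; apply; apply/rowP => i; rewrite !mxE.
by apply/eqP; rewrite -[_ == 0]negbK -normc_gt0 vi0 ltxx.
Qed.

(** The Ward identity.  It follows from [G - G^* = G (B^* - B) G^*] with
[B = H + diag w], where [B^* - B = - 2 i Im w] is diagonal because [H] is
Hermitian. *)
Lemma im_green w i : (forall j, Im (w 0 j) < 0) ->
  Im (green w i i) = \sum_j normc (green w i j) ^+ 2 * (- Im (w 0 j)).
Proof.
move=> w_lt0; have Bu := shifted_unit w_lt0.
set G := green w.
have GB : G *m shifted w = 1%:M by exact: mulVmx.
have BG' : adj (shifted w) *m adj G = 1%:M.
  by rewrite -trmx_mul -map_mxM GB map_mx1 trmx1.
have E : G - adj G = G *m diag_mx (map_mx (@conjc R) w - w) *m adj G.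
  have -> : diag_mx (map_mx (@conjc R) w - w) = adj (shifted w) - shifted w.
    by rewrite adj_shifted /shifted opprD addrACA subrr add0r -linearB.
  by rewrite mulmxBr mulmxBl -mulmxA BG' mulmx1 GB mul1mx.
have := congr1 (fun A : 'M[R[i]]_n => Im (A i i)) E; rewrite /=.
rewrite mul_mx_diag mxE [in RHS]mxE Im_sum.
have -> : Im (G i i + (- adj G) i i) = 2 * Im (G i i).
  by rewrite !mxE; case: (G i i) => a b /=; rewrite opprK mulr_natl.
move=> E2; apply: (@mulfI _ 2); rewrite ?pnatr_eq0// E2 mulr_sumr.
apply: eq_bigr => j _; rewrite !mxE mulrAC mulc_conjc ImMr.
by case: (w 0 j) => a b /=; ring.
Qed.

Lemma resolvent_identity w w' i j :
  (forall k, Im (w 0 k) < 0) -> (forall k, Im (w' 0 k) < 0) ->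
  green w i j - green w' i j
  = - \sum_k green w i k * green w' k j * (w 0 k - w' 0 k).
Proof.
move=> w_lt0 w'_lt0.
have E : green w - green w' = green w *m diag_mx (w' - w) *m green w'.
  have -> : diag_mx (w' - w) = shifted w' - shifted w.
    by rewrite /shifted opprD addrACA subrr add0r -linearB.
  rewrite mulmxBr mulmxBl -mulmxA mulmxV ?shifted_unit// mulmx1.
  by rewrite mulVmx ?shifted_unit// mul1mx.
have := congr1 (fun A : 'M[R[i]]_n => A i j) E; rewrite /= mul_mx_diag !mxE => ->.
rewrite -sumrN; apply: eq_bigr => k _; rewrite !mxE; ring.
Qed.

End Resolvent.

(** * Schur test *)

Lemma mulr_le_half_sqr (R : realFieldType) (x y : R) :
  x * y <= 2^-1 * (x ^+ 2 + y ^+ 2).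
Proof.
rewrite -subr_ge0 (_ : _ - _ = 2^-1 * (x - y) ^+ 2); last by field.
by rewrite mulr_ge0 ?sqr_ge0 ?invr_ge0.
Qed.

(** The two kernels have their own positive test vectors [v] and [v'].  Weighing
the pair [(i, j)] by the geometric means [r = sqrt (v v')] lets a single
inequality between arithmetic and geometric means split [g g'] into a term for
[v] and a term for [v']. *)
Lemma schur_test (R : rcfType) n (g g' : 'I_n -> 'I_n -> R)
    (v v' a : 'I_n -> R) (k : R) :
  (forall i j, 0 <= g i j) -> (forall i j, 0 <= g' i j) ->
  (forall i j, g i j = g j i) -> (forall i j, g' i j = g' j i) ->
  (forall i, 0 < v i) -> (forall i, 0 < v' i) ->
  (forall i, \sum_j g i j ^+ 2 * v j <= k * v i) ->
  (forall i, \sum_j g' i j ^+ 2 * v' j <= k * v' i) ->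
  \sum_i \sum_j g i j * g' i j * (a i * a j) <= k * \sum_i a i ^+ 2.
Proof.
move=> g0 g'0 gC g'C v0 v'0 gv g'v.
pose s i := Num.sqrt (v i); pose s' i := Num.sqrt (v' i).
have s0 i : s i != 0 by rewrite sqrtr_eq0 -ltNge.
have s'0 i : s' i != 0 by rewrite sqrtr_eq0 -ltNge.
have s2 i : s i ^+ 2 = v i by rewrite sqr_sqrtr ?ltW.
have s'2 i : s' i ^+ 2 = v' i by rewrite sqr_sqrtr ?ltW.
pose r i := s i * s' i.
have r0 i : 0 < r i by rewrite mulr_gt0 ?sqrtr_gt0.
pose q i j := g i j * g' i j * (r j / r i) * a i ^+ 2.
have -> : k * \sum_i a i ^+ 2 = \sum_i k * a i ^+ 2 by rewrite mulr_sumr.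
apply: (@le_trans _ _ (\sum_i \sum_j q i j)); last first.
  apply: ler_sum => i _; rewrite -mulr_suml ler_wpM2r ?sqr_ge0//.
  apply: (@le_trans _ _ (2^-1 * (\sum_j g i j ^+ 2 * v j / v i
                             + \sum_j g' i j ^+ 2 * v' j / v' i))).
    rewrite -big_split mulr_sumr; apply: ler_sum => j _ /=.
    have -> : g i j * g' i j * (r j / r i) =
        (g i j * (s j / s i)) * (g' i j * (s' j / s' i)).
      by rewrite /r; field; rewrite s0 s'0.
    apply: le_trans (mulr_le_half_sqr _ _) _.
    by rewrite !exprMn !exprVn !s2 !s'2 !mulrA.
  have h x y : 0 < y -> x <= k * y -> x / y <= k by move=> y0; rewrite ler_pdivrMr.
  have := h _ _ (v0 i) (gv i); have := h _ _ (v'0 i) (g'v i).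
  rewrite !mulr_suml; lra.
have -> : \sum_i \sum_j q i j = \sum_i \sum_j 2^-1 * (q i j + q j i).
  under [RHS]eq_bigr do rewrite -mulr_sumr big_split /=.
  rewrite -mulr_sumr big_split /= [X in _ + X]exchange_big /=.
  by field.
apply: ler_sum => i _; apply: ler_sum => j _.
have -> : 2^-1 * (q i j + q j i) = g i j * g' i j *
   (2^-1 * (r j / r i * a i ^+ 2 + r i / r j * a j ^+ 2)).
  by rewrite /q (gC j i) (g'C j i); field; rewrite !gt_eqF.
rewrite ler_wpM2l ?mulr_ge0// -subr_ge0.
have -> : 2^-1 * (r j / r i * a i ^+ 2 + r i / r j * a j ^+ 2) - a i * a j
   = 2^-1 * (r j * a i - r i * a j) ^+ 2 / (r i * r j).
  by field; rewrite !gt_eqF.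
by apply: divr_ge0; apply: mulr_ge0; rewrite ?sqr_ge0 ?invr_ge0 ?ltW.
Qed.

(** * Stability of the Dyson equation *)

Section ResolventBounds.
Context {R : rcfType} {n : nat}.
Variable (H : 'M[R]_n).
Hypothesis symH : H^T = H.
Implicit Types w : 'rV[R[i]]_n.

(** The Ward identity gives [e |G_ij|^2 <= Im G_ii]; its case [j = i] bounds the
diagonal, and the diagonal then bounds every entry. *)
Lemma normc_green_le w (e : R) i j : 0 < e -> (forall k, Im (w 0 k) <= - e) ->
  normc (green H w i j) <= e^-1.
Proof.
move=> e0 we.
have w0 k : Im (w 0 k) < 0 by rewrite (le_lt_trans (we k))// oppr_lt0.
have bnd k : e * normc (green H w i k) ^+ 2 <= Im (green H w i i).
  rewrite (im_green symH)// (bigD1 k)//= -[leLHS]addr0 lerD//.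
    by rewrite mulrC ler_wpM2l ?sqr_ge0// lerNr.
  by apply: sumr_ge0 => l _; rewrite mulr_ge0 ?sqr_ge0// oppr_ge0 ltW.
have dia : normc (green H w i i) <= e^-1.
  have : e * normc (green H w i i) ^+ 2 <= normc (green H w i i).
    exact: le_trans (bnd i) (le_trans (ler_norm _) (ler_Im_normc _)).
  have := normc_ge0 (green H w i i).
  rewrite le_eqVlt => /predU1P[<- _|x0]; first by rewrite invr_ge0 ltW.
  by rewrite expr2 mulrA ger_pMl// -ler_pdivlMl// mulr1.
have : e * normc (green H w i j) ^+ 2 <= e^-1.
  apply: le_trans (bnd j) _; apply: le_trans dia.
  exact: le_trans (ler_norm _) (ler_Im_normc _).
rewrite -ler_pdivlMl// -expr2 => h.
by rewrite -(@ler_pXn2r _ 2)// nnegrE ?normc_ge0// invr_ge0 ltW.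
Qed.

End ResolventBounds.

Section Dyson.
Context {R : rcfType} {n : nat}.
Variables (H : 'M[R]_n) (J : R).
Hypotheses (symH : H^T = H).
Implicit Types f m w : 'rV[R[i]]_n.

Definition spectral f m : 'rV[R[i]]_n := \row_i (f 0 i - (J ^+ 2)%:C * m 0 i).

(** The configuration [u] and the spectral parameter [z] enter only through
[f = u - z]; treating [f] as the variable lets derivatives in [u] and in [Im z]
share their proof. *)
Definition dyson f m :=
  (forall i, m 0 i = green H (spectral f m) i i) /\ forall i, 0 < Im (m 0 i).

Lemma im_spectral f m i :
  Im (spectral f m 0 i) = Im (f 0 i) - J ^+ 2 * Im (m 0 i).
Proof. by rewrite mxE ImB ImMr. Qed.

Section OneSolution.
Variables (f m : 'rV[R[i]]_n) (e E : R).
Hypotheses (e0 : 0 < e) (fe : forall i, Im (f 0 i) <= - e)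
  (fE : forall i, - E <= Im (f 0 i)) (dys : dyson f m).

Lemma im_spectral_le i : Im (spectral f m 0 i) <= - e.
Proof.
rewrite im_spectral lerBlDr (le_trans (fe i))// lerDl mulr_ge0 ?sqr_ge0//.
by rewrite ltW// dys.2.
Qed.

Lemma im_spectral_lt0 i : Im (spectral f m 0 i) < 0.
Proof. by rewrite (le_lt_trans (im_spectral_le i))// oppr_lt0. Qed.

Lemma normc_dyson_le i : normc (m 0 i) <= e^-1.
Proof. rewrite dys.1; exact/normc_green_le/im_spectral_le. Qed.

(** The contraction estimate for the stability operator.  By the Ward identity the
left-hand side is [J^2 Im m_i = - Im w_i + Im f_i]; the loss [- Im f_i >= e] is
turned into a factor by the upper bound [J^2 / e + E] for [- Im w_i]. *)
Lemma dyson_row_sum i :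
  \sum_j (J * normc (green H (spectral f m) i j)) ^+ 2
         * (- Im (spectral f m 0 j))
  <= (1 - e / (J ^+ 2 / e + E)) * - Im (spectral f m 0 i).
Proof.
under eq_bigr do rewrite exprMn -mulrA.
rewrite -mulr_sumr -(im_green symH) ?im_spectral_lt0//; last exact: im_spectral_lt0.
rewrite -dys.1 im_spectral opprB mulrBl mul1r.
have vE : J ^+ 2 * Im (m 0 i) - Im (f 0 i) <= J ^+ 2 / e + E.
  rewrite lerD// 1?lerNl// ler_wpM2l ?sqr_ge0//.
  exact: le_trans (ler_norm _) (le_trans (ler_Im_normc _) (normc_dyson_le i)).
have v0 : 0 < J ^+ 2 * Im (m 0 i) - Im (f 0 i).
  by have := im_spectral_lt0 i; rewrite im_spectral; lra.
set V := J ^+ 2 / e + E in vE *.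
set v := J ^+ 2 * _ - _ in vE v0 *.
have V0 : 0 < V := lt_le_trans v0 vE.
have : e / V * v <= e.
  by rewrite mulrAC ler_pdivrMr// ler_wpM2l// ltW.
have := fe i; rewrite /v; lra.
Qed.

End OneSolution.

Section TwoSolutions.
Variables (f m f' m' : 'rV[R[i]]_n) (e E : R).
Hypotheses (e0 : 0 < e) (fe : forall i, Im (f 0 i) <= - e)
  (fE : forall i, - E <= Im (f 0 i)) (dys : dyson f m)
  (f'e : forall i, Im (f' 0 i) <= - e)
  (f'E : forall i, - E <= Im (f' 0 i)) (dys' : dyson f' m').
Hypothesis (J0 : 0 <= J).

Let w := spectral f m.
Let w' := spectral f' m'.
Let c := e / (J ^+ 2 / e + E).

(** Monotonicity of the map from [f] to [w]: by the resolvent identity,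
[df = (1 - J^2 T) dw] where [T_ij = G'_ij G_ij], and the Schur test bounds
[J^2 T] by [1 - c]. *)
Lemma dyson_monotone :
  c * \sum_i normc (w' 0 i - w 0 i) ^+ 2 <=
  \sum_i Re ((f' 0 i - f 0 i) * conjc (w' 0 i - w 0 i)).
Proof.
set d := fun i => w' 0 i - w 0 i.
have df i : f' 0 i - f 0 i =
    d i - (J ^+ 2)%:C * \sum_j green H w' i j * green H w i j * d j.
  have -> : \sum_j green H w' i j * green H w i j * d j = - (m' 0 i - m 0 i).
    rewrite dys.1 dys'.1 (resolvent_identity symH).
    - by rewrite opprK; apply: eq_bigr => j _; rewrite (green_sym symH w j i).
    - exact: im_spectral_lt0 f'e dys'.
    - exact: im_spectral_lt0 fe dys.
  rewrite /d /w /w' !mxE; ring.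
have -> : \sum_i Re ((f' 0 i - f 0 i) * conjc (d i)) =
    \sum_i normc (d i) ^+ 2
    - \sum_i \sum_j J ^+ 2 * Re (green H w' i j * green H w i j * d j * conjc (d i)).
  rewrite -sumrB; apply: eq_bigr => i _.
  rewrite df mulrBl ReB mulc_conjc /=; congr (_ - _).
  by rewrite -mulrA ReMr mulr_suml Re_sum mulr_sumr.
have schur := @schur_test R n (fun i j => J * normc (green H w' i j))
  (fun i j => J * normc (green H w i j))
  (fun i => - Im (w' 0 i)) (fun i => - Im (w 0 i)) (fun i => normc (d i)) (1 - c).
have {}schur : \sum_i \sum_j J * normc (green H w' i j) * (J * normc (green H w i j)) *
   (normc (d i) * normc (d j)) <= (1 - c) * \sum_i normc (d i) ^+ 2.
  apply: schur => i *; rewrite ?mulr_ge0 ?normc_ge0//.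
  - by rewrite (green_sym symH).
  - by rewrite (green_sym symH).
  - by rewrite oppr_gt0 (im_spectral_lt0 e0 f'e dys').
  - by rewrite oppr_gt0 (im_spectral_lt0 e0 fe dys).
  - exact: dyson_row_sum.
  - exact: dyson_row_sum.
set S := \sum_i \sum_j _ in schur.
have : \sum_i \sum_j J ^+ 2 * Re (green H w' i j * green H w i j * d j * conjc (d i))
   <= S.
  apply: ler_sum => i _; apply: ler_sum => j _.
  rewrite (_ : _ * (_ * _) * _ = J ^+ 2 * (normc (green H w' i j) *
    normc (green H w i j) * normc (d j) * normc (d i))); last by ring.
  rewrite ler_wpM2l ?sqr_ge0//.
  apply: le_trans (ler_norm _) (le_trans (ler_Re_normc _) _).
  by rewrite !normcM normc_conjc.
move: schur; lra.
Qed.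

Lemma dyson_lipschitz : 0 < c ->
  c ^+ 2 * \sum_i normc (w' 0 i - w 0 i) ^+ 2 <=
  \sum_i normc (f' 0 i - f 0 i) ^+ 2.
Proof.
move=> c0.
have : c * \sum_i Re ((f' 0 i - f 0 i) * conjc (w' 0 i - w 0 i)) <=
    2^-1 * (\sum_i normc (f' 0 i - f 0 i) ^+ 2
            + c ^+ 2 * \sum_i normc (w' 0 i - w 0 i) ^+ 2).
  rewrite mulr_sumr [c ^+ 2 * _]mulr_sumr -big_split mulr_sumr /=.
  apply: ler_sum => i _; rewrite -exprMn.
  apply: le_trans (mulr_le_half_sqr _ _).
  rewrite mulrCA ler_wpM2l ?(ltW c0)//.
  apply: le_trans (ler_norm _) (le_trans (ler_Re_normc _) _).
  by rewrite normcM normc_conjc.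
have := ler_wpM2l (ltW c0) dyson_monotone.
rewrite mulrA -expr2; lra.
Qed.

End TwoSolutions.
End Dyson.

(** * The logarithm of a determinant near the identity *)

Section LogDet.
Context {R : realType}.

(** With [z = a + i b] this estimates [log |1 + z|]; it follows from
[1 - 1/y <= log y <= y - 1] at [y = |1 + z|^2]. *)
Lemma ln_sqr_dist1 (a b : R) : a ^+ 2 + b ^+ 2 <= 16^-1 ->
  `|2^-1 * ln ((1 + a) ^+ 2 + b ^+ 2) - a| <= 9 * (a ^+ 2 + b ^+ 2).
Proof.
move=> ab; set q := a ^+ 2 + b ^+ 2 in ab *.
have q0 : 0 <= q by rewrite addr_ge0 ?sqr_ge0.
have b2 := sqr_ge0 b.
have a_ge : - 4^-1 <= a.
  rewrite leNgt; apply/negP => alt.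
  have : 4^-1 ^+ 2 < a ^+ 2.
    by rewrite -(sqrrN a) ltr_pXn2r ?nnegrE ?invr_ge0//; lra.
  have : a ^+ 2 <= 16^-1 by apply: le_trans ab; rewrite /q; lra.
  lra.
have a2 : a ^+ 2 <= q by rewrite /q; lra.
have -> : (1 + a) ^+ 2 + b ^+ 2 = 1 + (2 * a + q) by rewrite /q; ring.
set y := 2 * a + q.
have y_ge : - 2^-1 <= y by rewrite /y; lra.
have y1 : 0 < 1 + y by lra.
have up : ln (1 + y) <= y by apply: le_ln1Dx; lra.
have lo : y - 2 * y ^+ 2 <= ln (1 + y).
  have E : (1 + y)^-1 = 1 + (- (y / (1 + y))) by field; rewrite gt_eqF.
  have h : - ln (1 + y) <= - (y / (1 + y)).
    have y1' : -1 < - (y / (1 + y)) by rewrite ltrN2 ltr_pdivrMr//; lra.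
    by have := le_ln1Dx y1'; rewrite -E lnV ?posrE.
  have : y - 2 * y ^+ 2 <= y / (1 + y).
    rewrite ler_pdivlMr//; have := sqr_ge0 y; nra.
  lra.
have y2 : y ^+ 2 <= 8 * a ^+ 2 + 2 * q ^+ 2.
  have := sqr_ge0 (2 * a - q); rewrite /y; nra.
have q2 : q ^+ 2 <= 16^-1 * q by nra.
by rewrite ler_norml; apply/andP; split; rewrite /y in up lo y2; lra.
Qed.

Lemma ln_normcE (z : R[i]) : ln (normc z) = 2^-1 * ln (Re z ^+ 2 + Im z ^+ 2).
Proof.
rewrite -sqr_normcE; have [->|z0] := eqVneq z 0.
  by rewrite normc_real normr0 expr0n /= ln0// mulr0.
by rewrite lnXn ?normc_gt0// mulr2n; field.
Qed.

Lemma ln_normc_1D (z : R[i]) : normc z <= 4^-1 ->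
  `|ln (normc (1 + z)) - Re z| <= 9 * normc z ^+ 2.
Proof.
move=> z4; rewrite ln_normcE ReD ImD /= add0r sqr_normcE.
apply: ln_sqr_dist1; rewrite -sqr_normcE (_ : 16^-1 = 4^-1 ^+ 2 :> R); last by field.
by rewrite ler_pXn2r ?nnegrE ?normc_ge0 ?invr_ge0.
Qed.

(** Compare the [l^1] norms of a left eigenvector [v] and of [v X]. *)
Lemma eigenvalue_normc_le n (X : 'M[R[i]]_n) (e : R) (l : R[i]) :
  (forall i j, normc (X i j) <= e) -> eigenvalue X l -> normc l <= n%:R * e.
Proof.
move=> Xe /eigenvalueP[v vX vn0].
pose S := \sum_i normc (v 0 i).
have S0 : 0 < S.
  have [i vi] : exists i, v 0 i != 0.
    apply/existsP; apply: contraNT vn0 => /existsPn v0.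
    by apply/eqP/rowP => i; rewrite mxE; apply/eqP; have := v0 i; rewrite negbK.
  rewrite /S (bigD1 i)//= ltr_pwDl ?normc_gt0//.
  by apply: sumr_ge0 => j _; exact: normc_ge0.
rewrite -(ler_pM2r S0) {1}/S mulr_sumr.
have -> : n%:R * e * S = \sum_(j < n) e * S.
  by rewrite sumr_const card_ord -mulrA mulr_natl.
apply: ler_sum => j _.
rewrite -normcM (_ : l * v 0 j = (v *m X) 0 j); last by rewrite vX mxE.
rewrite mxE /S mulr_sumr; apply: le_trans (normc_sum _ _ _) _.
by apply: ler_sum => i _; rewrite normcM mulrC ler_wpM2r ?normc_ge0.
Qed.

Lemma horner_char_poly n (X : 'M[R[i]]_n) (x : R[i]) :
  (char_poly X).[x] = \det (x%:M - X).
Proof.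
rewrite /char_poly -[LHS]/(horner_eval x _) -det_map_mx; congr (\det _).
by apply/matrixP => i j; rewrite !mxE /= /horner_eval hornerD hornerN hornerMn hornerX hornerC.
Qed.

(** Over the complex numbers [det (1 + X)] and [tr X] are the product of the
[1 + l] and the sum of the [l], for [l] ranging over the eigenvalues of [X], and
the eigenvalues are bounded by the entries. *)
Lemma ln_det_1D n (X : 'M[R[i]]_n) (e : R) :
  (forall i j, normc (X i j) <= e) -> n%:R * e <= 4^-1 -> 0 <= e ->
  \det (1%:M + X) != 0 /\
  `|ln (normc (\det (1%:M + X))) - Re (\tr X)| <= n%:R * (9 * (n%:R * e) ^+ 2).
Proof.
move=> Xe ne e0.
have [s sE] := closed_field_poly_normal (char_poly X).
rewrite (monicP (char_poly_monic X)) scale1r in sE.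
have size_s : size s = n.
  by have := size_char_poly X; rewrite sE size_prod_XsubC => -[].
have ls l : l \in s -> normc l <= n%:R * e.
  move=> ls; apply: (eigenvalue_normc_le Xe).
  by rewrite eigenvalue_root_char sE root_prod_XsubC.
have trE : \tr X = \sum_(l <- s) l.
  have [n0|n0] := posnP n.
    rewrite (size0nil (_ : size s = 0)) ?big_nil ?size_s//.
    by rewrite /mxtrace big1// => i; have := ltn_ord i; rewrite {2}n0.
  apply: oppr_inj; rewrite -char_poly_trace// sE -{1}size_s coefPn_prod_XsubC//.
  by rewrite size_s -lt0n.
have detE : normc (\det (1%:M + X)) = \prod_(l <- s) normc (1 + l).
  have := horner_char_poly X (-1).
  have -> : (-1)%:M - X = -1 *: (1%:M + X).
    by rewrite scalerDr !scaleN1r raddfN.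
  rewrite detZ sE horner_prod => /(congr1 (fun z => normc z)).
  rewrite normcM normc_prod => dE.
  have n1 : normc ((-1 : R[i]) ^+ n) = 1.
    have -> : normc ((-1 : R[i]) ^+ n) = normc (-1 : R[i]) ^+ n.
      elim: n {X Xe ne sE size_s ls trE dE} => [|k IH]; first by rewrite !expr0 normc_real normr1.
      by rewrite !exprS normcM IH.
    by rewrite normcN normc_real normr1 expr1n.
  rewrite n1 mul1r in dE; rewrite -dE; apply: eq_bigr => l _.
  by rewrite !hornerE -normcN opprB opprK addrC.
have l1 l : l \in s -> 0 < normc (1 + l).
  move=> sl; rewrite normc_gt0; apply/negP => /eqP l1.
  have := ls _ sl; have -> : l = -1 by rewrite -[RHS]addr0 -l1 addKr.
  rewrite normcN normc_real normr1; lra.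
have det0 : \det (1%:M + X) != 0.
  by rewrite -normc_gt0 detE big_seq; apply: prodr_gt0 => l; exact: l1.
split => //; rewrite trE detE Re_sum.
have -> : ln (\prod_(l <- s) normc (1 + l)) = \sum_(l <- s) ln (normc (1 + l)).
  elim: {trE detE size_s sE ls} s l1 => [|l s IH] l1; first by rewrite !big_nil ln1.
  rewrite !big_cons lnM ?posrE ?l1 ?mem_head//.
    by rewrite IH// => k ks; rewrite l1// in_cons ks orbT.
  by rewrite big_seq prodr_gt0// => k ks; rewrite l1// in_cons ks orbT.
rewrite -sumrB -{1}size_s; apply: le_trans (ler_norm_sum _ _ _) _.
have -> : (size s)%:R * (9 * (n%:R * e) ^+ 2) = \sum_(l <- s) 9 * (n%:R * e) ^+ 2.
  by rewrite big_const_seq count_predT iter_addr addr0 mulr_natl.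
rewrite big_seq [leRHS]big_seq; apply: ler_sum => l sl.
apply: le_trans (ln_normc_1D (le_trans (ls _ sl) ne)) _.
by rewrite ler_wpM2l// ler_pXn2r ?nnegrE ?normc_ge0 ?mulr_ge0// ls.
Qed.

End LogDet.

(** * The action functional *)

Section QuadraticRemainder.
Context {R : realType}.

Lemma is_derive_quadratic (g : R -> R) (t d K r : R) : 0 < r ->
  (forall s, `|s - t| < r -> `|g s - g t - d * (s - t)| <= K * (s - t) ^+ 2) ->
  is_derive t 1 g d.
Proof.
move=> r0 rem.
have lim : h^-1 *: (g (h *: 1 + t) - g t) @[h --> 0^'] --> d.
  apply/cvgrPdist_le => eps eps0.
  have K0 : 0 < `|K| + 1 by rewrite ltr_wpDl.
  near=> h.
  have h0 : h != 0 by near: h; exact: nbhs_dnbhs_neq.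
  have hr : `|h| < r.
    by near: h; apply: dnbhs0_lt.
  have heps : `|h| <= eps / (`|K| + 1).
    by near: h; apply: dnbhs0_le; rewrite divr_gt0.
  have := rem (h + t); rewrite addrK => /(_ hr) remh.
  rewrite /= [h *: 1]mulr1 -normrN opprB.
  have -> : h^-1 *: (g (h + t) - g t) - d = h^-1 * (g (h + t) - g t - d * h).
    by rewrite [_ *: _]mulrC; field.
  rewrite normrM normfV ler_pdivrMl ?normr_gt0//.
  apply: le_trans remh _.
  have -> : h ^+ 2 = `|h| * `|h| by rewrite -normrM -expr2 ger0_norm ?sqr_ge0.
  rewrite mulrCA ler_wpM2l//.
  rewrite ler_pdivlMr// in heps.
  have := ler_norm K; have := normr_ge0 h; nra.
by apply: DeriveDef; [apply/cvg_ex; exists d|exact/cvg_lim].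
Unshelve. all: by end_near. Qed.

End QuadraticRemainder.

Section Action.
Context {R : realType} {n : nat}.
Variables (H : 'M[R]_n) (J : R).
Hypotheses (symH : H^T = H) (J0 : 0 < J).
Implicit Types f m w : 'rV[R[i]]_n.

(** The functional whose stationary points in [m] are the solutions of the Dyson
equation: its partial derivative in [m_i] is [J^2 (m_i - G_ii)]. *)
Definition action f m : R :=
  ln (normc (\det (shifted H (spectral J f m))))
  + 2^-1 * J ^+ 2 * Re (\sum_i m 0 i ^+ 2).

(** [H + diag w'] is [H + diag w] times [1 + G(w) diag (w' - w)]. *)
Lemma ln_det_shifted (w w' : 'rV[R[i]]_n) (e q : R) :
  0 < e -> (forall i, Im (w 0 i) <= - e) ->
  0 <= q -> (forall i, normc (w' 0 i - w 0 i) <= q) ->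
  n%:R * (e^-1 * q) <= 4^-1 ->
  `|ln (normc (\det (shifted H w'))) - ln (normc (\det (shifted H w)))
    - Re (\sum_i green H w i i * (w' 0 i - w 0 i))|
  <= n%:R * (9 * (n%:R * (e^-1 * q)) ^+ 2).
Proof.
move=> e0 we q0 wq nq.
have w_lt0 i : Im (w 0 i) < 0 by rewrite (le_lt_trans (we i))// oppr_lt0.
have Bu := shifted_unit symH w_lt0.
pose X := green H w *m diag_mx (w' - w).
have -> : shifted H w' = shifted H w *m (1%:M + X).
  rewrite mulmxDr mulmx1 /X mulmxA mulmxV// mul1mx /shifted -addrA -linearD.
  by rewrite /= [w + _]addrC subrK.
have Xe i j : normc (X i j) <= e^-1 * q.
  rewrite /X mul_mx_diag !mxE normcM.
  by rewrite ler_pM ?normc_ge0// (normc_green_le symH).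
have eq0 : 0 <= e^-1 * q by rewrite mulr_ge0// invr_ge0 ltW.
have [det0 dle] := ln_det_1D Xe nq eq0.
have detB0 : \det (shifted H w) != 0 by rewrite -unitfE -unitmxE.
rewrite det_mulmx normcM lnM ?posrE ?normc_gt0//.
have -> : \sum_i green H w i i * (w' 0 i - w 0 i) = \tr X.
  by apply: eq_bigr => i _; rewrite /X mul_mx_diag !mxE.
by rewrite [ln _ + _]addrC addrK.
Qed.

Definition in_strip (e E : R) f := forall i, - E <= Im (f 0 i) <= - e.

(** The envelope principle: to first order the variations of [w] and [m] cancel
and only [sum_i m_i df_i] is left.  The Lipschitz bound on [w] makes the
remainder quadratic in [df]. *)
Lemma action_remainder (e E : R) : 0 < e -> 0 < E ->
  exists K q0, 0 < q0 /\ forall f m f' m',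
    in_strip e E f -> in_strip e E f' -> dyson H J f m -> dyson H J f' m' ->
    \sum_i normc (f' 0 i - f 0 i) ^+ 2 <= q0 ->
    `|action f' m' - action f m - Re (\sum_i m 0 i * (f' 0 i - f 0 i))|
    <= K * \sum_i normc (f' 0 i - f 0 i) ^+ 2.
Proof.
move=> e0 E0; pose c := e / (J ^+ 2 / e + E).
have J2 : 0 < J ^+ 2 by rewrite exprn_gt0.
have c0 : 0 < c by apply: divr_gt0 => //; apply: addr_gt0 => //; apply: divr_gt0.
exists (n%:R * (9 * (n%:R * (e^-1 * c^-1)) ^+ 2) + (J ^+ 2)^-1 * (1 + c ^- 2)).
exists ((4^-1 * (n%:R + 1)^-1 * e * c) ^+ 2).
have n10 : 0 < n%:R + 1 :> R by rewrite ltr_wpDl.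
have q_gt0 : 0 < 4^-1 * (n%:R + 1)^-1 * e * c.
  by rewrite (mulr_gt0 _ c0)// (mulr_gt0 _ e0)// mulr_gt0 ?invr_gt0.
split; first by rewrite exprn_gt0.
move=> f m f' m' fS f'S dys dys'; set Q := \sum_i _ => Qq0.
have fe i : Im (f 0 i) <= - e by case/andP: (fS i).
have fE i : - E <= Im (f 0 i) by case/andP: (fS i).
have f'e i : Im (f' 0 i) <= - e by case/andP: (f'S i).
have f'E i : - E <= Im (f' 0 i) by case/andP: (f'S i).
have lip := dyson_lipschitz symH e0 fe fE dys f'e f'E dys' (ltW J0) c0.
rewrite -/c -/Q in lip.
set w := spectral J f m in lip *; set w' := spectral J f' m' in lip *.
set W := \sum_i _ in lip.
have Q0 : 0 <= Q by apply: sumr_ge0 => i _; exact: sqr_ge0.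
have WQ : W <= c ^- 2 * Q by rewrite ler_pdivlMl// exprn_gt0.
pose q := c^-1 * Num.sqrt Q.
have q0 : 0 <= q by rewrite mulr_ge0 ?sqrtr_ge0// invr_ge0 ltW.
have wq i : normc (w' 0 i - w 0 i) <= q.
  rewrite -(@ler_pXn2r _ 2)// ?nnegrE ?normc_ge0//.
  rewrite exprMn sqr_sqrtr// exprVn; apply: le_trans WQ.
  rewrite /W (bigD1 i)//= lerDl; apply: sumr_ge0 => j _; exact: sqr_ge0.
have nq : n%:R * (e^-1 * q) <= 4^-1.
  have sQ : Num.sqrt Q <= 4^-1 * (n%:R + 1)^-1 * e * c.
    rewrite -(@ler_pXn2r _ 2)// ?nnegrE ?sqrtr_ge0//; last exact: ltW.
    by rewrite sqr_sqrtr.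
  apply: (@le_trans _ _ (n%:R * (e^-1 * (c^-1 * (4^-1 * (n%:R + 1)^-1 * e * c))))).
    rewrite ler_wpM2l// ler_wpM2l ?invr_ge0 ?(ltW e0)//.
    by rewrite ler_wpM2l ?invr_ge0 ?(ltW c0).
  have -> : n%:R * (e^-1 * (c^-1 * (4^-1 * (n%:R + 1)^-1 * e * c)))
     = 4^-1 * (n%:R / (n%:R + 1)) :> R.
    by field; rewrite !gt_eqF.
  rewrite -[leRHS]mulr1 ler_wpM2l ?invr_ge0// ler_pdivrMr// mul1r lerDl //.
have w_le i : Im (w 0 i) <= - e by exact: im_spectral_le fe dys i.
have det_le := ln_det_shifted e0 w_le q0 wq nq.
have q2 : q ^+ 2 = c ^- 2 * Q by rewrite exprMn sqr_sqrtr// exprVn.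
pose dm i := m' 0 i - m 0 i.
(* The definition of w expresses the variation of m by those of f and w. *)
have dmE i : (J ^+ 2)%:C * dm i = (f' 0 i - f 0 i) - (w' 0 i - w 0 i).
  by rewrite /dm /w /w' !mxE; ring.
have dm_le i : J ^+ 2 * normc (dm i) ^+ 2 <=
    (J ^+ 2)^-1 * (2 * (normc (f' 0 i - f 0 i) ^+ 2 + normc (w' 0 i - w 0 i) ^+ 2)).
  rewrite ler_pdivlMl// mulrA -expr2 -exprMn.
  have -> : J ^+ 2 * normc (dm i) = normc ((f' 0 i - f 0 i) - (w' 0 i - w 0 i)).
    by rewrite -dmE normcM normc_real ger0_norm// ltW.
  set x := f' 0 i - _; set y := w' 0 i - _.
  apply: (@le_trans _ _ ((normc x + normc y) ^+ 2)).
    by rewrite ler_pXn2r ?nnegrE ?addr_ge0 ?normc_ge0// -[normc y]normcN normcD.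
  have := sqr_ge0 (normc x - normc y); nra.
have main : action f' m' - action f m - Re (\sum_i m 0 i * (f' 0 i - f 0 i)) =
  (ln (normc (\det (shifted H w'))) - ln (normc (\det (shifted H w)))
    - Re (\sum_i green H w i i * (w' 0 i - w 0 i)))
  + 2^-1 * (J ^+ 2 * Re (\sum_i dm i ^+ 2)).
  have -> : \sum_i green H w i i * (w' 0 i - w 0 i) = \sum_i m 0 i * (w' 0 i - w 0 i).
    by apply: eq_bigr => i _; rewrite dys.1.
  have E1 : 2^-1 * (J ^+ 2 * Re (\sum_i dm i ^+ 2)) =
    2^-1 * J ^+ 2 * Re (\sum_i m' 0 i ^+ 2) - 2^-1 * J ^+ 2 * Re (\sum_i m 0 i ^+ 2)
    - Re (\sum_i m 0 i * ((f' 0 i - f 0 i) - (w' 0 i - w 0 i))).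
    rewrite mulrA !Re_sum !mulr_sumr -!sumrB; apply: eq_bigr => i _.
    rewrite -dmE [m 0 i * _]mulrCA ReMr /dm !expr2 !ReM !ReB !ImB; by field.
  have E2 : Re (\sum_i m 0 i * ((f' 0 i - f 0 i) - (w' 0 i - w 0 i))) =
      Re (\sum_i m 0 i * (f' 0 i - f 0 i)) - Re (\sum_i m 0 i * (w' 0 i - w 0 i)).
    by rewrite -ReB -sumrB; congr Re; apply: eq_bigr => i _; rewrite mulrBr.
  rewrite E1 E2 /action -/w -/w'; ring.
rewrite main; apply: le_trans (ler_normD _ _) _; rewrite [leRHS]mulrDl lerD//.
  apply: le_trans det_le _.
  have -> : (n%:R * (e^-1 * q)) ^+ 2 = (n%:R * (e^-1 * c^-1)) ^+ 2 * Q.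
    by rewrite [n%:R * (_ * q)]mulrA exprMn q2 -exprVn; ring.
  by rewrite !mulrA.
rewrite normrM ger0_norm ?invr_ge0// normrM (ger0_norm (ltW J2)).
apply: (@le_trans _ _ (2^-1 * \sum_i J ^+ 2 * normc (dm i) ^+ 2)).
  rewrite ler_wpM2l ?invr_ge0// -mulr_sumr ler_wpM2l ?(ltW J2)//.
  apply: le_trans (ler_Re_normc _) (le_trans (normc_sum _ _ _) _).
  by apply: ler_sum => i _; rewrite !expr2 normcM.
apply: (@le_trans _ _ (2^-1 * ((J ^+ 2)^-1 * (2 * (Q + W))))).
  rewrite ler_wpM2l ?invr_ge0// /Q /W -big_split /= !mulr_sumr; apply: ler_sum => i _.
  exact: dm_le.
have -> : 2^-1 * ((J ^+ 2)^-1 * (2 * (Q + W))) = (J ^+ 2)^-1 * (Q + W).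
  by field; rewrite gt_eqF.
rewrite -mulrA ler_wpM2l ?invr_ge0 ?(ltW J2)//; lra.
Qed.

Lemma is_derive_action (F M : R -> 'rV[R[i]]_n) (h : 'I_n -> R[i]) (t r e E : R) :
  0 < r -> 0 < e -> 0 < E ->
  (forall s i, F s 0 i = F t 0 i + (s - t)%:C * h i) ->
  (forall s, `|s - t| < r -> in_strip e E (F s)) ->
  (forall s, `|s - t| < r -> dyson H J (F s) (M s)) ->
  is_derive t 1 (fun s => action (F s) (M s)) (Re (\sum_i M t 0 i * h i)).
Proof.
move=> r0 e0 E0 Fh FS dys.
have [K [q0 [q00 rem]]] := action_remainder e0 E0.
pose S := \sum_i normc (h i) ^+ 2.
have S0 : 0 <= S by apply: sumr_ge0 => i _; exact: sqr_ge0.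
have S10 : 0 < S + 1 by rewrite ltr_wpDl.
have QE s : \sum_i normc (F s 0 i - F t 0 i) ^+ 2 = (s - t) ^+ 2 * S.
  rewrite /S mulr_sumr; apply: eq_bigr => i _.
  by rewrite Fh addrC addKr normcM normc_real exprMn real_normK ?num_real.
have tt : `|t - t| < r by rewrite subrr normr0.
pose d := Num.sqrt (q0 / (S + 1)).
have d0 : 0 < d by rewrite sqrtr_gt0 divr_gt0.
apply: (@is_derive_quadratic _ _ _ _ (K * S) (Num.min r d)).
  by rewrite lt_min r0 d0.
move=> s; rewrite lt_min => /andP[sr sd].
have small : (s - t) ^+ 2 * S <= q0.
  have : (s - t) ^+ 2 <= q0 / (S + 1).
    have <- : d ^+ 2 = q0 / (S + 1) by rewrite sqr_sqrtr// divr_ge0 ?ltW.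
    by rewrite -[leLHS]real_normK ?num_real// ler_pXn2r ?nnegrE ?normr_ge0 ?ltW.
  rewrite ler_pdivlMr// => h1; apply: le_trans h1.
  by rewrite ler_wpM2l ?sqr_ge0// lerDl.
have := rem _ _ _ _ (FS _ tt) (FS _ sr) (dys _ tt) (dys _ sr).
rewrite QE => /(_ small); rewrite [_ ^+ 2 * S]mulrC mulrA.
congr (`|_ - _| <= _).
rewrite !Re_sum mulr_suml; apply: eq_bigr => i _.
by rewrite Fh [F t 0 i + _]addrC addrK mulrCA ReMr mulrC.
Qed.

End Action.

(** * Concavity at positive height *)

Section RealCalculus.
Context {R : realType}.

Lemma nonincreasing_derive_concave (g dg : R -> R) :
  (forall t : R, is_derive t 1 g (dg t)) -> (forall s t, s <= t -> dg t <= dg s) ->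
  forall t, 0 <= t -> t <= 1 -> t * g 1 + (1 - t) * g 0 <= g t.
Proof.
move=> gd dgn t t0 t1.
have gc (a b : R) : {within `[a, b], continuous g}.
  apply: continuous_subspaceT => x; apply: differentiable_continuous.
  by apply/derivable1_diffP; have := gd x; case.
have [c1 c1i E1] := MVT_segment t0 (fun x _ => gd x) (gc _ _).
have [c2 c2i E2] := MVT_segment t1 (fun x _ => gd x) (gc _ _).
have c12 : c1 <= c2.
  by move: c1i c2i; rewrite !in_itv /= => /andP[_ h1] /andP[h2 _]; exact: le_trans h2.
have := dgn _ _ c12 => dle.
have : 0 <= t * (1 - t) * (dg c1 - dg c2).
  by rewrite !mulr_ge0// subr_ge0.
have -> : g 1 = g t + dg c2 * (1 - t) by rewrite -E2; ring.
have -> : g 0 = g t - dg c1 * t by move: E1; rewrite subr0 => <-; ring.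
lra.
Qed.

Lemma vanishing_of_derive0 (D : R -> R) (C x0 : R) :
  (forall x : R, 0 < x -> is_derive x 1 D 0) -> 0 < x0 ->
  (forall x, x0 <= x -> `|D x| <= C / x) ->
  forall x, 0 < x -> D x = 0.
Proof.
move=> D0 x00 DC x x_gt0.
have cst y : x <= y -> D x = D y.
  move=> xy.
  have Dd z : z \in `]x, y[%R -> is_derive z 1 D 0.
    by rewrite in_itv /= => /andP[xz _]; apply: D0; exact: lt_trans xz.
  have Dc : {within `[x, y], continuous D}.
    apply: derivable_within_continuous => z; rewrite in_itv /= => /andP[xz _].
    by have := D0 z (lt_le_trans x_gt0 xz); case.
  have [c _ /eqP] := MVT_segment xy Dd Dc.
  by rewrite mul0r subr_eq0 => /eqP.
apply/eqP; rewrite -normr_eq0 eq_le normr_ge0 andbT leNgt; apply/negP => Dx.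
pose y := Num.max (Num.max x x0) ((`|C| + 1) / `|D x|).
have xy : x <= y by rewrite !le_max lexx.
have x0y : x0 <= y by rewrite !le_max lexx !orbT.
have y0 : 0 < y by exact: lt_le_trans x0y.
have Cy : (`|C| + 1) / `|D x| <= y by rewrite !le_max lexx !orbT.
have := DC _ x0y; rewrite -(cst _ xy) ler_pdivlMr// => h.
rewrite ler_pdivrMr// in Cy; have := ler_norm C; nra.
Qed.

End RealCalculus.

Section AtFixedHeight.
Context {R : realType} {n : nat}.
Variables (H : 'M[R]_n) (J : R).
Hypotheses (symH : H^T = H) (J0 : 0 < J).
Implicit Types u : 'rV[R]_n.

(** The value of [u - z] at [z = i eta]. *)
Definition external_field (u : 'rV[R]_n) (eta : R) : 'rV[R[i]]_n :=
  \row_i Complex (u 0 i) (- eta).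

Lemma external_field_in_strip u eta : in_strip eta eta (external_field u eta).
Proof. by move=> i; rewrite mxE /= lexx. Qed.

(** On a segment, the derivative of the left-hand functional is
[- J^-2 sum_i h_i Re w_i], and [dyson_monotone] makes it nonincreasing. *)
Lemma action_concave (eta : R) (m : 'rV[R]_n -> 'rV[R[i]]_n) : 0 < eta ->
  (forall u, dyson H J (external_field u eta) (m u)) ->
  concave_function (fun u => action H J (external_field u eta) (m u)
                             - (\sum_i u 0 i ^+ 2) / (2 * J ^+ 2)).
Proof.
move=> eta0 dys x y t t0 t1.
pose h := x - y.
pose U s : 'rV[R]_n := y + s *: h.
have U1 : U 1 = x by rewrite /U scale1r addrC subrK.
have U0 : U 0 = y by rewrite /U scale0r addr0.
have Ut : U t = t *: x + (1 - t) *: y.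
  by apply/rowP => i; rewrite !mxE; ring.
have J2 : 0 < J ^+ 2 by rewrite exprn_gt0.
pose w s := spectral J (external_field (U s) eta) (m (U s)).
pose g s := action H J (external_field (U s) eta) (m (U s))
            - (\sum_i U s 0 i ^+ 2) / (2 * J ^+ 2).
suff : t * g 1 + (1 - t) * g 0 <= g t by rewrite /g U1 U0 Ut.
apply: (@nonincreasing_derive_concave _ g
  (fun s => - (J ^+ 2)^-1 * \sum_i h 0 i * Re (w s 0 i))) => //.
- move=> s.
  have d1 : is_derive s 1 (fun s => action H J (external_field (U s) eta) (m (U s)))
      (Re (\sum_i m (U s) 0 i * (h 0 i)%:C)).
    apply: (@is_derive_action _ _ _ _ symH J0 (fun s => external_field (U s) eta)
      (fun s => m (U s)) (fun i => (h 0 i)%:C) s 1 eta eta) => //.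
      move=> s' i; rewrite !mxE; apply/eqP; rewrite eq_complex /=.
      by apply/andP; split; apply/eqP; ring.
    by move=> s' _; exact: external_field_in_strip.
  have d2 : is_derive s 1 (fun s => (\sum_i U s 0 i ^+ 2) / (2 * J ^+ 2))
      ((J ^+ 2)^-1 * \sum_i U s 0 i * h 0 i).
    apply: (@is_derive_quadratic _ _ _ _ ((2 * J ^+ 2)^-1 * \sum_i h 0 i ^+ 2) 1) => // s' _.
    rewrite (_ : _ - _ - _ = (2 * J ^+ 2)^-1 * (\sum_i h 0 i ^+ 2) * (s' - s) ^+ 2); last first.
      rewrite !mulr_suml !mulr_sumr !mulr_suml -!sumrB; apply: eq_bigr => i _.
      by rewrite !mxE; field; rewrite gt_eqF.
    have h2 : 0 <= \sum_i h 0 i ^+ 2 by apply: sumr_ge0 => i _; exact: sqr_ge0.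
    have J2V : 0 <= (2 * J ^+ 2)^-1 by rewrite invr_ge0 mulr_ge0// ltW.
    by rewrite ger0_norm// mulr_ge0 ?sqr_ge0// mulr_ge0.
  have d := is_deriveB d1 d2.
  apply: is_derive_eq.
  rewrite Re_sum !mulr_sumr -sumrB; apply: eq_bigr => i _.
  by rewrite /w !mxE ReM ReB ReMr /=; field; rewrite gt_eqF.
- move=> s s'; rewrite le_eqVlt => /predU1P[-> //|ss'].
  rewrite !mulNr lerN2 ler_wpM2l ?invr_ge0 ?(ltW J2)//.
  have fe v i : Im (external_field v eta 0 i) <= - eta by rewrite mxE.
  have fE v i : - eta <= Im (external_field v eta 0 i) by rewrite mxE.
  have := dyson_monotone symH eta0 (fe (U s)) (fE (U s)) (dys (U s))
    (fe (U s')) (fE (U s')) (dys (U s')) (ltW J0).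
  rewrite -/(w s) -/(w s') => mono.
  have {mono} : 0 <= \sum_i Re ((external_field (U s') eta 0 i - external_field (U s) eta 0 i)
                     * conjc (w s' 0 i - w s 0 i)).
    apply: le_trans mono; rewrite mulr_ge0//.
      by rewrite divr_ge0 ?addr_ge0 ?divr_ge0 ?(ltW eta0)// ltW.
    by apply: sumr_ge0 => i _; exact: sqr_ge0.
  have -> : \sum_i Re ((external_field (U s') eta 0 i - external_field (U s) eta 0 i)
                     * conjc (w s' 0 i - w s 0 i)) =
     (s' - s) * (\sum_i h 0 i * Re (w s' 0 i) - \sum_i h 0 i * Re (w s 0 i)).
    rewrite -sumrB mulr_sumr; apply: eq_bigr => i _.
    have -> : external_field (U s') eta 0 i - external_field (U s) eta 0 i = ((s' - s) * h 0 i)%:C.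
      rewrite !mxE; apply/eqP; rewrite eq_complex /=.
      by apply/andP; split; apply/eqP; ring.
    rewrite ReMr -mulrBr mulrA -ReB.
    by case: (w s' 0 i - w s 0 i).
  by rewrite pmulr_rge0 ?subr_gt0// subr_ge0.
Qed.

Lemma is_derive_action_height u (m : R -> 'rV[R[i]]_n) (t : R) : 0 < t ->
  (forall s, 0 < s -> dyson H J (external_field u s) (m s)) ->
  is_derive t 1 (fun s => action H J (external_field u s) (m s)) (\sum_i Im (m t 0 i)).
Proof.
move=> t0 dys.
have -> : \sum_i Im (m t 0 i) = Re (\sum_i m t 0 i * Complex 0 (-1)).
  by rewrite Re_sum; apply: eq_bigr => i _; rewrite ReM /=; ring.
have half : 0 < t / 2 by rewrite divr_gt0.
have near_t s : `|s - t| < t / 2 -> t / 2 < s /\ s < 2 * t.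
  by rewrite ltr_norml => /andP[h1 h2]; split; lra.
apply: (@is_derive_action _ _ _ _ symH J0 (external_field u) m (fun=> Complex 0 (-1)) t
  (t / 2) (t / 2) (2 * t)) => //.
- by rewrite mulr_gt0.
- move=> s i; rewrite !mxE; apply/eqP; rewrite eq_complex /=.
  by apply/andP; split; apply/eqP; ring.
- by move=> s /near_t[h1 h2] i; rewrite mxE /= !lerN2 !ltW.
- by move=> s /near_t[h1 _]; apply: dys; exact: lt_trans h1.
Qed.

Lemma normc_exp (z : R[i]) k : normc (z ^+ k) = normc z ^+ k.
Proof.
elim: k => [|k IH]; first by rewrite !expr0 normc_real normr1.
by rewrite !exprS normcM IH.
Qed.

(** At height [t] the matrix is [- i t (1 + X)] with [X = O(1/t)], and
[|m_i| <= 1/t]. *)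
Lemma action_at_infinity u (m : R -> 'rV[R[i]]_n) :
  (forall s, 0 < s -> dyson H J (external_field u s) (m s)) ->
  exists C t0, 0 < t0 /\ forall t, t0 <= t ->
    `|action H J (external_field u t) (m t) - n%:R * ln t| <= C / t.
Proof.
move=> dys.
have J2 : 0 <= J ^+ 2 by rewrite sqr_ge0.
pose B := \sum_i \sum_j `|H i j| + \sum_i `|u 0 i| + J ^+ 2.
have Hs : 0 <= \sum_i \sum_j `|H i j|.
  by apply: sumr_ge0 => i _; apply: sumr_ge0.
have us : 0 <= \sum_i `|u 0 i| by apply: sumr_ge0.
have B0 : 0 <= B by rewrite !addr_ge0.
have nB : 0 <= n%:R * B by rewrite mulr_ge0.
exists (n%:R * B + n%:R * (9 * (n%:R * B) ^+ 2) + 2^-1 * J ^+ 2 * n%:R).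
exists (1 + 4 * (n%:R * B)); split; first by lra.
move=> t tB.
have t1 : 1 <= t by lra.
have t0 : 0 < t by lra.
have ti0 : 0 < t^-1 by rewrite invr_gt0.
have ti1 : t^-1 <= 1 by rewrite invf_le1.
have fe i : Im (external_field u t 0 i) <= - t by rewrite mxE.
have m_le i : normc (m t 0 i) <= t^-1 := normc_dyson_le symH t0 fe (dys t t0) i.
set w := spectral J (external_field u t) (m t).
pose z : R[i] := Complex 0 (- t).
pose X : 'M[R[i]]_n := z^-1 *: (shifted H w - z%:M).
have z0 : z != 0.
  by rewrite eq_complex /= negb_and oppr_eq0 (gt_eqF t0) orbT.
have zn : normc z = t by rewrite /= expr0n /= add0r sqrrN sqrtr_sqr gtr0_norm.
have E : shifted H w = z *: (1%:M + X).
  by rewrite /X scalerDr scalerA mulfV// scale1r scalemx1 addrC subrK.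
have Xe i j : normc (X i j) <= t^-1 * B.
  rewrite !mxE normcM normcV zn ler_wpM2l ?(ltW ti0)//.
  have -> : (H i j)%:C + (Complex (u 0 i) (- t) - (J ^+ 2)%:C * m t 0 i) *+ (i == j)
      - z *+ (i == j) =
      (H i j)%:C + ((u 0 i)%:C - (J ^+ 2)%:C * m t 0 i) *+ (i == j).
    rewrite -addrA -mulrnBl; congr (_ + _ *+ _).
    rewrite addrAC; congr (_ - _); apply/eqP; rewrite eq_complex /=.
    by apply/andP; split; apply/eqP; ring.
  apply: le_trans (normcD _ _) _; rewrite normc_real /B -addrA lerD//.
    rewrite (bigD1 i)//= (bigD1 j)//= -addrA lerDl addr_ge0// ?sumr_ge0// => k _.
    by apply: sumr_ge0.
  case: (i == j); last by rewrite mulr0n normc_real normr0 addr_ge0.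
  rewrite mulr1n; apply: le_trans (normcD _ _) _; rewrite normcN lerD//.
    by rewrite normc_real (bigD1 i)//= lerDl sumr_ge0.
  rewrite normcM normc_real ger0_norm// -[leRHS]mulr1 ler_wpM2l//.
  exact: le_trans (m_le i) ti1.
have ne : n%:R * (t^-1 * B) <= 4^-1.
  by rewrite mulrCA ler_pdivrMl//; lra.
have e0 : 0 <= t^-1 * B by rewrite mulr_ge0// ltW.
have [det0 dle] := ln_det_1D Xe ne e0.
have tr_le : `|Re (\tr X)| <= n%:R * (t^-1 * B).
  rewrite /mxtrace; apply: le_trans (ler_Re_normc _) (le_trans (normc_sum _ _ _) _).
  apply: (@le_trans _ _ (\sum_(i < n) t^-1 * B)); first exact: ler_sum.
  by rewrite sumr_const card_ord mulr_natl.
have m2_le : `|2^-1 * J ^+ 2 * Re (\sum_i m t 0 i ^+ 2)| <= 2^-1 * J ^+ 2 * (n%:R * t^-1).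
  have hJ : 0 <= 2^-1 * J ^+ 2 by rewrite mulr_ge0 ?invr_ge0.
  rewrite normrM (ger0_norm hJ) (ler_wpM2l hJ)//.
  apply: le_trans (ler_Re_normc _) (le_trans (normc_sum _ _ _) _).
  apply: (@le_trans _ _ (\sum_(i < n) t^-1)); last first.
    by rewrite sumr_const card_ord mulr_natl.
  apply: ler_sum => i _; rewrite expr2 normcM -[leRHS]mulr1.
  by rewrite ler_pM ?normc_ge0// (le_trans (m_le i)).
have -> : action H J (external_field u t) (m t) - n%:R * ln t =
    ln (normc (\det (1%:M + X))) + 2^-1 * J ^+ 2 * Re (\sum_i m t 0 i ^+ 2).
  rewrite /action -/w E detZ normcM normc_exp zn lnM ?posrE ?exprn_gt0 ?normc_gt0//.
  by rewrite lnXn// mulr_natl; ring.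
have t2 : n%:R * (9 * (n%:R * (t^-1 * B)) ^+ 2) <= n%:R * (9 * (n%:R * B) ^+ 2) * t^-1.
  have -> : n%:R * (9 * (n%:R * B) ^+ 2) * t^-1 = n%:R * (9 * ((n%:R * B) ^+ 2 * t^-1)).
    by ring.
  apply: ler_wpM2l => //; apply: ler_wpM2l => //.
  have -> : (n%:R * (t^-1 * B)) ^+ 2 = (n%:R * B) ^+ 2 * (t^-1 * t^-1) by ring.
  apply: ler_wpM2l; first exact: sqr_ge0.
  by apply: ler_piMr => //; exact: ltW.
apply: le_trans (ler_normD _ _) _.
have : `|ln (normc (\det (1%:M + X)))| <=
    n%:R * (9 * (n%:R * (t^-1 * B)) ^+ 2) + n%:R * (t^-1 * B).
  rewrite -[X in `|X|](subrK (Re (\tr X))).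
  by apply: (le_trans (ler_normD _ _)); exact: lerD.
rewrite !mulrDl -[2^-1 * J ^+ 2 * n%:R * t^-1]mulrA.
have -> : n%:R * B * t^-1 = n%:R * (t^-1 * B) by ring.
move: m2_le t2; lra.
Qed.

End AtFixedHeight.

(** * Logarithmic potential of a bounded compactly supported density *)

Section Density.
Context {R : realType}.
Variables (mu : probability (measurableTypeR R) R) (rho : R -> R).
Hypothesis rhoP : bounded_compact_density mu rho.

Let leb := (@lebesgue_measure R).

Lemma measurable_density : measurable_fun [set: measurableTypeR R] rho.
Proof. by case: rhoP. Qed.

Lemma density_ge0 x : 0 <= rho x.
Proof. by case: rhoP. Qed.

Lemma density_support :
  exists2 K, 1 <= K & forall x, rho x != 0 -> `|x| <= K.
Proof.
case: rhoP => _ _ _ cpt _.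
have [M [_ MP]] := compact_bounded cpt.
exists (`|M| + 1); first by rewrite lerDr.
move=> x rx; apply: (MP (`|M| + 1)); last exact: subset_closure.
by rewrite ltr_pwDr// ler_norm.
Qed.

Lemma integral_density : (\int[leb]_x (rho x)%:E = 1)%E.
Proof.
by case: rhoP => _ _ _ _ rE; rewrite -rE// probability_setT.
Qed.

Lemma integrable_density : leb.-integrable setT (EFin \o rho).
Proof.
apply/integrableP; split.
  by apply/measurable_EFinP; exact: measurable_density.
under eq_integral do rewrite /= ger0_norm ?density_ge0//.
by rewrite integral_density ltry.
Qed.

(** The density agrees almost everywhere with the Radon-Nikodym derivative, for
which the change of variables holds. *)
Lemma ge0_integral_density (f : R -> R) :
  measurable_fun [set: measurableTypeR R] f -> (forall x, 0 <= f x) ->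
  (\int[mu]_x (f x)%:E = \int[leb]_x (f x * rho x)%:E)%E.
Proof.
move=> mf f0; have mr := measurable_density.
have rE : forall A : set (measurableTypeR R), measurable A ->
    (mu A = \int[leb]_(x in A) (rho x)%:E)%E by case: rhoP.
have dom : mu `<< leb.
  apply/null_content_dominatesP => A mA A0; rewrite rE//.
  apply: null_set_integral => //.
  by apply/measurable_EFinP; exact: measurable_funTS.
pose g := Radon_Nikodym_SigmaFinite.f mu leb.
have g_rho : ae_eq leb setT g (EFin \o rho).
  apply: integral_ae_eq => //.
  - exact: Radon_Nikodym_SigmaFinite.f_integrable.
  - by apply/measurable_EFinP.
  - move=> A _ mA; rewrite -(Radon_Nikodym_SigmaFinite.f_integral dom)//; exact: rE.
rewrite -(Radon_Nikodym_SigmaFinite.change_of_variables dom)//; last exact/measurable_EFinP.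
apply: ae_eq_integral => //.
- apply: emeasurable_funM; first by apply/measurable_EFinP.
  by apply: measurable_int; exact: Radon_Nikodym_SigmaFinite.f_integrable.
- by apply/measurable_EFinP; exact: measurable_funM.
- have := @ae_eqe_mul2l _ _ _ leb setT _ _ (EFin \o f) g_rho.
  by apply: filterS => x /(_ I) /= + _ => ->.
Qed.

Lemma integrable_mul_density (g : R -> R) (B : R) :
  measurable_fun [set: measurableTypeR R] g ->
  (forall x, rho x != 0 -> `|g x| <= B) ->
  leb.-integrable setT (EFin \o (fun x => g x * rho x)).
Proof.
move=> mg gB; have mr := measurable_density.
apply: (@le_integrable _ _ _ leb _ _ _ (fun x => B%:E * (EFin \o rho) x)%E) => //.
- by apply/measurable_EFinP; exact: measurable_funM.
- move=> x _; rewrite /= lee_fin !normrM.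
  have [->|r0] := eqVneq (rho x) 0; first by rewrite normr0 !mulr0.
  by rewrite ler_wpM2r// (le_trans (gB _ r0))// ler_norm.
- exact: integrableZl integrable_density.
Qed.

Lemma Rintegral_mul_density_le (g : R -> R) (B : R) :
  measurable_fun [set: measurableTypeR R] g ->
  (forall x, rho x != 0 -> `|g x| <= B) ->
  `|\int[leb]_x (g x * rho x)| <= B.
Proof.
move=> mg gB; have gi := integrable_mul_density mg gB.
apply: le_trans (le_normr_Rintegral _ gi) _ => //.
have <- : \int[leb]_x (B * rho x) = B.
  rewrite RintegralZl//; last exact: integrable_density.
  by rewrite /Rintegral integral_density mulr1.
apply: le_Rintegral => //.
- exact: (@integrable_abse _ _ _ leb _ _ gi).
- exact: integrableZl integrable_density.
- move=> x _; rewrite normrM (ger0_norm (density_ge0 x)).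
  have [->|r0] := eqVneq (rho x) 0; first by rewrite !mulr0.
  by rewrite ler_wpM2r ?density_ge0// gB.
Qed.

(** [log |x - i t|], the logarithm smoothed at height [t]. *)
Definition half_ln (t x : R) : R := 2^-1 * ln (x ^+ 2 + t ^+ 2).

Lemma measurable_half_ln t : measurable_fun [set: measurableTypeR R] (half_ln t).
Proof.
apply: measurable_funM; first exact: measurable_cst.
apply: (measurableT_comp (@measurable_ln R)).
apply: measurable_funD; last exact: measurable_cst.
exact: measurable_funX.
Qed.

(** The derivative of [half_ln t x] in [t], and also the imaginary part of
[1 / (x - i t)]. *)
Definition poisson_kernel (t x : R) : R := t / (x ^+ 2 + t ^+ 2).

Lemma measurable_poisson t : 0 < t ->
  measurable_fun [set: measurableTypeR R] (poisson_kernel t).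
Proof.
move=> t0; apply: continuous_measurable_fun => x.
apply: cvgM; first exact: cvg_cst.
apply: cvgV; first by rewrite gt_eqF// ltr_wpDl ?sqr_ge0 ?exprn_gt0.
by apply: cvgD; [exact: exprn_continuous|exact: cvg_cst].
Qed.

Definition log_potential (t : R) : R := \int[leb]_x (half_ln t x * rho x).

Lemma half_ln_bounded (t : R) : 0 < t ->
  exists B, forall x, rho x != 0 -> `|half_ln t x| <= B.
Proof.
move=> t0; have [K K1 rK] := density_support.
exists (`|ln (t ^+ 2)| + `|ln (K ^+ 2 + t ^+ 2)|) => x rx.
have xK := rK x rx.
have t20 : 0 < t ^+ 2 by rewrite exprn_gt0.
have x2K : x ^+ 2 <= K ^+ 2.
  by rewrite -real_normK ?num_real// ler_pXn2r ?nnegrE// (le_trans _ xK).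
have x0 := sqr_ge0 x.
have lo : ln (t ^+ 2) <= ln (x ^+ 2 + t ^+ 2).
  by rewrite ler_ln ?posrE ?lerDr// ltr_wpDl.
have hi : ln (x ^+ 2 + t ^+ 2) <= ln (K ^+ 2 + t ^+ 2).
  by rewrite ler_ln ?posrE ?lerD2r// ltr_wpDl// sqr_ge0.
rewrite /half_ln normrM ger0_norm ?invr_ge0//.
have : `|ln (x ^+ 2 + t ^+ 2)| <= `|ln (t ^+ 2)| + `|ln (K ^+ 2 + t ^+ 2)|.
  rewrite ler_norml; apply/andP; split.
    have := ler_norm (- ln (t ^+ 2)); rewrite normrN.
    have := normr_ge0 (ln (K ^+ 2 + t ^+ 2)); lra.
  have := ler_norm (ln (K ^+ 2 + t ^+ 2)); have := normr_ge0 (ln (t ^+ 2)); lra.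
have := normr_ge0 (ln (x ^+ 2 + t ^+ 2)); lra.
Qed.

Lemma poisson_le (t x : R) : 0 < t -> `|poisson_kernel t x| <= t^-1.
Proof.
move=> t0; have x0 := sqr_ge0 x; have t20 : 0 < t ^+ 2 by rewrite exprn_gt0.
have d0 : 0 < x ^+ 2 + t ^+ 2 by rewrite ltr_wpDl.
rewrite /poisson_kernel ger0_norm; last by rewrite divr_ge0 ?ltW.
by rewrite ler_pdivrMr// mulrC -ler_pdivrMr ?invr_gt0// invrK -expr2 lerDr.
Qed.

Lemma integrable_half_ln t : 0 < t ->
  leb.-integrable setT (EFin \o (fun x => half_ln t x * rho x)).
Proof.
move=> /half_ln_bounded[B hB].
exact: integrable_mul_density (measurable_half_ln t) hB.
Qed.

Lemma integrable_poisson t : 0 < t ->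
  leb.-integrable setT (EFin \o (fun x => poisson_kernel t x * rho x)).
Proof.
move=> t0; apply: (integrable_mul_density (measurable_poisson t0)) => x _.
exact: poisson_le.
Qed.

(** [x - i s = (x - i t) (1 + z)] with [z = (s - t) (t + i x) / (x^2 + t^2)] up to
conjugation, so the bound is that of [ln_sqr_dist1]. *)
Lemma half_ln_taylor (t s x : R) : 0 < t -> `|s - t| < t / 4 ->
  `|half_ln s x - half_ln t x - poisson_kernel t x * (s - t)| <= 9 * (s - t) ^+ 2 / t ^+ 2.
Proof.
move=> t0; set h := s - t => ht.
have -> : s = t + h by rewrite /h addrC subrK.
have x0 := sqr_ge0 x; have t20 : 0 < t ^+ 2 by rewrite exprn_gt0.
set d := x ^+ 2 + t ^+ 2.
have d0 : 0 < d by rewrite ltr_wpDl.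
pose a := h * t / d; pose b := h * x / d.
have ab : a ^+ 2 + b ^+ 2 = h ^+ 2 / d.
  by rewrite /a /b /d; field; rewrite gt_eqF.
have hd : h ^+ 2 / d <= h ^+ 2 / t ^+ 2.
  by rewrite ler_wpM2l ?sqr_ge0// lef_pV2 ?posrE// lerDr.
have ht2 : h ^+ 2 / t ^+ 2 <= 16^-1.
  rewrite ler_pdivrMr// -real_normK ?num_real//.
  have -> : 16^-1 * t ^+ 2 = (t / 4) ^+ 2 by field.
  by rewrite ler_pXn2r ?nnegrE ?normr_ge0 ?divr_ge0// ltW.
have := @ln_sqr_dist1 R a b; rewrite ab => /(_ (le_trans hd ht2)) main.
have -> : half_ln (t + h) x - half_ln t x - poisson_kernel t x * h =
    2^-1 * ln ((1 + a) ^+ 2 + b ^+ 2) - a.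
  have E : x ^+ 2 + (t + h) ^+ 2 = ((1 + a) ^+ 2 + b ^+ 2) * d.
    by rewrite /a /b /d; field; rewrite gt_eqF.
  have q0 : 0 < (1 + a) ^+ 2 + b ^+ 2.
    rewrite -(pmulr_lgt0 _ d0) -E ltr_wpDl// exprn_gt0//.
    by move: ht; rewrite ltr_norml => /andP[]; lra.
  rewrite /half_ln E lnM ?posrE// -/d /poisson_kernel -/d /a; field.
  by rewrite gt_eqF.
apply: le_trans main _; rewrite -mulrA ler_wpM2l//.
Qed.

Lemma is_derive_log_potential (t : R) : 0 < t ->
  is_derive t 1 log_potential (\int[leb]_x (poisson_kernel t x * rho x)).
Proof.
move=> t0; apply: (@is_derive_quadratic _ _ _ _ (9 / t ^+ 2) (t / 4)).
  by rewrite divr_gt0.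
move=> s st.
have s0 : 0 < s by move: st; rewrite ltr_norml => /andP[]; lra.
have is_ := integrable_half_ln s0; have it_ := integrable_half_ln t0.
have ip_ := integrable_poisson t0.
have -> : log_potential s - log_potential t
   - \int[leb]_x (poisson_kernel t x * rho x) * (s - t) =
   \int[leb]_x ((half_ln s x - half_ln t x - poisson_kernel t x * (s - t)) * rho x).
  rewrite -RintegralZr// /log_potential -RintegralB//.
  rewrite -RintegralB//.
  - by apply: eq_Rintegral => x _; ring.
  - exact: (integrableB measurableT is_ it_).
  - exact: (integrableZr measurableT _ ip_).
rewrite mulrAC; apply: Rintegral_mul_density_le => [|x _]; last exact: half_ln_taylor.
apply: measurable_funB.
  by apply: measurable_funB; exact: measurable_half_ln.
by apply: measurable_funM; [exact: measurable_poisson|exact: measurable_cst].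
Qed.

Lemma im_stieltjes (t : R) : 0 < t ->
  Im (stieltjes mu (Complex 0 t)) = \int[leb]_x (poisson_kernel t x * rho x).
Proof.
move=> t0; rewrite /stieltjes /= /Rintegral; congr fine.
rewrite -ge0_integral_density//.
- apply: eq_integral => x _; congr EFin.
  by rewrite /poisson_kernel /= !(subr0, sub0r, sqrrN, oppr0, add0r, addr0) mulNr opprK.
- exact: measurable_poisson.
- move=> x; rewrite /poisson_kernel divr_ge0 ?ltW// ltr_wpDl ?sqr_ge0 ?exprn_gt0//.
Qed.

Lemma log_potential_at_infinity :
  exists C, forall t, 1 <= t -> `|log_potential t - ln t| <= C / t.
Proof.
have [K K1 rK] := density_support; exists (K ^+ 2) => t t1.
have t0 : 0 < t by exact: lt_le_trans t1.
have -> : log_potential t - ln t = \int[leb]_x ((half_ln t x - ln t) * rho x).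
  have {1}-> : ln t = \int[leb]_x (ln t * rho x).
    rewrite RintegralZl//; last exact: integrable_density.
    by rewrite /Rintegral integral_density mulr1.
  rewrite -RintegralB//; last 2 first.
  - exact: integrable_half_ln.
  - exact: integrableZl integrable_density.
  by apply: eq_Rintegral => x _; ring.
apply: Rintegral_mul_density_le => [|x rx].
  by apply: measurable_funB; [exact: measurable_half_ln|exact: measurable_cst].
have xK := rK x rx.
have x2K : x ^+ 2 <= K ^+ 2.
  by rewrite -real_normK ?num_real// ler_pXn2r ?nnegrE// (le_trans _ xK).
have x0 := sqr_ge0 x; have t20 : 0 < t ^+ 2 by rewrite exprn_gt0.
have q0 : 0 <= x ^+ 2 / t ^+ 2 by rewrite divr_ge0// ltW.
have -> : half_ln t x - ln t = 2^-1 * ln (1 + x ^+ 2 / t ^+ 2).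
  have -> : 1 + x ^+ 2 / t ^+ 2 = (x ^+ 2 + t ^+ 2) / t ^+ 2.
    by field; rewrite gt_eqF.
  rewrite /half_ln ln_div ?posrE ?ltr_wpDl// lnXn// mulr2n; by field.
have hi : ln (1 + x ^+ 2 / t ^+ 2) <= x ^+ 2 / t ^+ 2 by apply: le_ln1Dx; lra.
have lo : 0 <= ln (1 + x ^+ 2 / t ^+ 2) by apply: ln_ge0; rewrite lerDl.
have b : x ^+ 2 / t ^+ 2 <= K ^+ 2 / t.
  rewrite ler_pM// ?invr_ge0 ?(ltW t20)// lef_pV2 ?posrE//.
  by rewrite expr2 ler_peMl// ltW.
by rewrite ger0_norm ?mulr_ge0 ?invr_ge0//; lra.
Qed.

End Density.

(** * Vanishing height *)

Section VanishingHeight.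
Context {R : realType}.
Let leb := (@lebesgue_measure R).

Lemma is_derive_half_ln (t x : R) : 0 < t ->
  is_derive x 1 (half_ln t) (x / (x ^+ 2 + t ^+ 2)).
Proof.
move=> t0; have d0 : 0 < x ^+ 2 + t ^+ 2 by rewrite ltr_wpDl ?sqr_ge0 ?exprn_gt0.
have dln := is_derive1_ln d0.
have dsq : is_derive x 1 (fun x : R => x ^+ 2 + t ^+ 2) (2 * x).
  apply: (@is_derive_quadratic _ _ _ _ 1 1) => // s _.
  rewrite (_ : _ - _ - _ = (s - x) ^+ 2); last by ring.
  by rewrite mul1r ger0_norm ?sqr_ge0.
have dc := @is_derive1_comp R (@ln R) (fun x => x ^+ 2 + t ^+ 2) x _ _ dln dsq.
have d : is_derive x 1 (half_ln t) _ := is_deriveM (is_derive_cst (2^-1 : R) x (1 : R)) dc.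
apply: (is_derive_eq d).
rewrite scaler0 addr0 /= /GRing.scale /=; field.
by rewrite gt_eqF.
Qed.

(** The primitive of the smoothed logarithm is elementary; this is what makes the
integrals below bounded uniformly in the height. *)
Definition half_ln_primitive (t x : R) : R := x * half_ln t x - x + t * atan (x / t).

Lemma is_derive_half_ln_primitive (t x : R) : 0 < t ->
  is_derive x 1 (half_ln_primitive t) (half_ln t x).
Proof.
move=> t0; have d0 : 0 < x ^+ 2 + t ^+ 2 by rewrite ltr_wpDl ?sqr_ge0 ?exprn_gt0.
have dh := is_derive_half_ln x t0.
have dq : is_derive x 1 (fun x : R => x / t) t^-1.
  apply: (@is_derive_quadratic _ _ _ _ 0 1) => // s _.
  by rewrite (_ : _ - _ - _ = 0) ?normr0 ?mul0r//; field; rewrite gt_eqF.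
have da := @is_derive1_comp R (@atan R) (fun x => x / t) x _ _ (is_derive1_atan (x / t)) dq.
have dta := is_deriveM (is_derive_cst (t : R) x (1 : R)) da.
have dm := is_deriveM (is_derive_id x (1 : R)) dh.
have d : is_derive x 1 (half_ln_primitive t) _ :=
  is_deriveD (is_deriveB dm (is_derive_id x (1 : R))) dta.
apply: (is_derive_eq d).
rewrite scaler0 addr0 /= /GRing.scale /=; field.
by rewrite !gt_eqF// addrC.
Qed.


Lemma atan_ge0 (x : R) : 0 <= x -> 0 <= atan x.
Proof. by move=> x0; rewrite -(@atan0 R) le_atan. Qed.

Lemma half_ln0 (x : R) : x != 0 -> half_ln 0 x = ln `|x|.
Proof.
move=> x0; rewrite /half_ln expr0n /= addr0 -real_normK ?num_real//.
by rewrite lnXn ?normr_gt0// mulr2n; field.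
Qed.

Lemma ln_norm_le_half_ln (t x : R) : x != 0 -> ln `|x| <= half_ln t x.
Proof.
move=> x0; rewrite -half_ln0// /half_ln ler_wpM2l ?invr_ge0//.
have x2 : 0 < x ^+ 2 by rewrite lt_def sqrf_eq0 x0 sqr_ge0.
have t2 := sqr_ge0 t.
by rewrite expr0n /= addr0 ler_ln ?posrE ?lerDl// ltr_pwDl.
Qed.

Lemma half_ln_le_at1 (t x K : R) : 0 < t -> t <= 1 -> `|x| <= K ->
  half_ln t x <= half_ln 1 K.
Proof.
move=> t0 t1 xK; have K0 : 0 <= K by exact: le_trans xK.
rewrite /half_ln ler_wpM2l ?invr_ge0//.
rewrite ler_ln ?posrE ?ltr_wpDl ?sqr_ge0 ?exprn_gt0//.
rewrite lerD//; last by rewrite ler_pXn2r ?nnegrE ?(ltW t0).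
by rewrite -[leLHS]real_normK ?num_real// ler_pXn2r ?nnegrE.
Qed.

Lemma cvg_half_ln (x : R) : x != 0 ->
  half_ln (k.+1%:R^-1) x @[k --> \oo] --> ln `|x|.
Proof.
move=> x0; rewrite -half_ln0//.
apply: cvgM; first exact: cvg_cst.
have x2 : 0 < x ^+ 2 + 0 ^+ 2.
  by rewrite expr0n /= addr0 lt_def sqrf_eq0 x0 sqr_ge0.
apply: (cvg_comp (fun k : nat => x ^+ 2 + k.+1%:R^-1 ^+ 2) (@ln R)); last first.
  exact: continuous_ln x2.
apply: cvgD; first exact: cvg_cst.
apply: (cvg_comp (fun k : nat => k.+1%:R^-1 : R) (fun y : R => y ^+ 2)).
  exact: cvg_harmonic.
exact: exprn_continuous.
Qed.

Lemma integral_half_ln_le (C t K : R) : 0 < t -> 1 <= K ->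
  (\int[leb]_(x in `[(- K)%R, K%R]%classic) (C - half_ln t x)%:E <= (2 * K * C + 2 * K)%:E)%E.
Proof.
move=> t0 K1; have K0 : 0 < K by lra.
pose G (x : R) : R := C * x - half_ln_primitive t x.
have dG (x : R) : is_derive x 1 G (C - half_ln t x).
  have dC : is_derive x 1 (fun x : R => C * x) C.
    apply: (@is_derive_quadratic _ _ _ _ 0 1) => // s _.
    by rewrite (_ : _ - _ - _ = 0) ?normr0 ?mul0r//; ring.
  exact: is_deriveB dC (is_derive_half_ln_primitive x t0).
have cG x : {for x, continuous G}.
  by apply: differentiable_continuous; apply/derivable1_diffP; case: (dG x).
have cf : continuous (fun x => C - half_ln t x).
  have ch x : {for x, continuous (half_ln t)}.
    apply: differentiable_continuous; apply/derivable1_diffP.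
    by case: (is_derive_half_ln x t0).
  by move=> x; apply: cvgB; [exact: cvg_cst|exact: ch].
rewrite (@continuous_FTC2 _ (fun x => C - half_ln t x) G); first last.
- by move=> x _; rewrite derive1E; have [_ ->] := dG x.
- split; first by move=> x _; case: (dG x).
  + exact/cvg_at_right_filter/cG.
  + exact/cvg_at_left_filter/cG.
- exact: continuous_subspaceT.
- lra.
rewrite -EFinB lee_fin /G /half_ln_primitive.
have -> : half_ln t (- K) = half_ln t K by rewrite /half_ln sqrrN.
rewrite !mulNr atanN.
have hK : 0 <= half_ln t K.
  rewrite /half_ln mulr_ge0 ?invr_ge0// ln_ge0//.
  by rewrite -[leLHS]addr0 lerD ?sqr_ge0// expr_ge1// ltW.
have aK : 0 <= t * atan (K / t) by rewrite mulr_ge0 ?(ltW t0)// atan_ge0 ?divr_ge0 ?ltW.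
have := mulr_ge0 (ltW K0) hK; lra.
Qed.

Lemma integrable_cst_punctured (C K : R) : 0 < K ->
  leb.-integrable (`[(- K), K] `\ 0) (EFin \o cst C).
Proof.
move=> K0; have mD : measurable (`[(- K), K] `\ 0 : set (measurableTypeR R)).
  exact: measurableD.
apply: measurable_bounded_integrable => //; last exact: bounded_cst.
apply: (@le_lt_trans _ _ (leb `[(- K), K]%classic)).
  by apply: le_measure; rewrite ?inE//; move=> x [].
by rewrite /leb lebesgue_measure_itv /= lte_fin gtrN// -EFinB ltry.
Qed.

(** The functions [C - half_ln t x] are nonnegative and increase to [C - log |x|]
as [t] decreases to [0], with bounded integrals; Fatou's lemma concludes.  The
origin is removed because [ln 0 = 0] there, which is not the limit. *)
Lemma integrable_ln_norm (K : R) : 1 <= K ->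
  leb.-integrable (`[(- K), K] `\ 0) (EFin \o (fun x => ln `|x|)).
Proof.
move=> K1; have K0 : 0 < K by lra.
set D := _ `\ _.
have mD : measurable (D : set (measurableTypeR R)) by exact: measurableD.
have mln : measurable_fun [set: measurableTypeR R] (fun x : R => ln `|x|).
  by apply: (measurableT_comp (@measurable_ln R)); exact: normr_measurable.
pose C := half_ln 1 K.
pose f (k : nat) (x : R) := (C - half_ln (k.+1%:R^-1) x)%:E.
have tk0 k : 0 < k.+1%:R^-1 :> R by rewrite invr_gt0.
have tk1 k : k.+1%:R^-1 <= 1 :> R by rewrite invf_le1// ler1n.
have fC k (x : R) : `|x| <= K -> half_ln (k.+1%:R^-1) x <= C.
  exact: half_ln_le_at1 (tk0 k) (tk1 k).
have DK (x : R) : x \in `[(- K), K]%R -> `|x| <= K by rewrite in_itv /= ler_norml.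
have lnC (x : R) : x != 0 -> `|x| <= K -> ln `|x| <= C.
  by move=> x0 xK; apply: le_trans (fC 0%N _ xK); exact: ln_norm_le_half_ln.
have mf k (A : set (measurableTypeR R)) : measurable_fun A (f k).
  apply: measurable_funTS; apply/measurable_EFinP; apply: measurable_funB.
    exact: measurable_cst.
  exact: measurable_half_ln.
have fat : (\int[leb]_(x in D) (C - ln `|x|)%:E <= (2 * K * C + 2 * K)%:E)%E.
  have -> : (\int[leb]_(x in D) (C - ln `|x|)%:E =
             \int[leb]_(x in D) limn_einf (f ^~ x))%E.
    apply: eq_integral => x; rewrite inE => -[_ /= /eqP x0].
    have cv : f ^~ x @ \oo --> (C - ln `|x|)%:E.
      apply: cvg_EFin; first exact: nearW.
      by apply: cvgB; [exact: cvg_cst|exact: cvg_half_ln].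
    by have [-> _] := cvg_limn_einf_sup cv.
  apply: le_trans (fatou _ mD _ _) _; first by move=> k; exact: mf.
    by move=> k x [/DK xK _]; rewrite lee_fin subr_ge0 fC.
  rewrite limn_einf_lim; apply: lime_le; first exact: is_cvg_einfs.
  apply: nearW => k; apply: (@le_trans _ _ (\int[leb]_(x in D) f k x)%E).
    by apply: ereal_inf_lbound; exists k => /=.
  apply: le_trans (integral_half_ln_le C (tk0 k) K1).
  apply: ge0_subset_integral => //.
    by move=> x /DK xK; rewrite lee_fin subr_ge0 fC.
  by move=> x [].
have intC : leb.-integrable D (EFin \o (fun x : R => C - ln `|x|)).
  apply/integrableP; split.
    apply: measurable_funTS; apply/measurable_EFinP; apply: measurable_funB => //.
  apply: le_lt_trans (ltry (2 * K * C + 2 * K)); apply: le_trans fat.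
  rewrite le_eqVlt; apply/orP; left; apply/eqP; apply: eq_integral => x.
  by rewrite inE => -[/DK xK /= /eqP x0]; rewrite ger0_norm// subr_ge0 lnC.
have intc : leb.-integrable D (EFin \o cst C) := integrable_cst_punctured C K0.
have E : EFin \o (fun x : R => ln `|x|) =
    ((EFin \o cst C) \- (EFin \o (fun x : R => C - ln `|x|)%R))%E.
  by apply/funext => x /=; rewrite -EFinB; congr EFin; ring.
by rewrite E; exact: integrableB.
Qed.

End VanishingHeight.

Section Limit.
Context {R : realType}.
Let leb := (@lebesgue_measure R).
Variables (mu : probability (measurableTypeR R) R) (rho : R -> R).
Hypothesis rhoP : bounded_compact_density mu rho.

Lemma log_potential_cvg : log_potential rho (k.+1%:R^-1) @[k --> \oo] -->
  \int[leb]_x (ln `|x| * rho x).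
Proof.
have [K K1 rK] := density_support rhoP.
have mrho := measurable_density rhoP.
have [M rM] : exists M, forall x, rho x <= M by case: rhoP.
have M0 : 0 <= M by exact: le_trans (density_ge0 rhoP 0) (rM 0).
pose D := `[- K, K]%classic `\ (0 : R).
have mD : measurable (D : set (measurableTypeR R)) by exact: measurableD.
pose C := half_ln 1 K.
have tk0 k : 0 < k.+1%:R^-1 :> R by rewrite invr_gt0.
have tk1 k : k.+1%:R^-1 <= 1 :> R by rewrite invf_le1// ler1n.
have K0 : 0 < K by lra.
have C0 : 0 <= C.
  rewrite /C /half_ln mulr_ge0 ?invr_ge0// ln_ge0// expr1n.
  by rewrite lerDr sqr_ge0.
have hC k (x : R) : x != 0 -> `|x| <= K -> `|half_ln (k.+1%:R^-1) x| <= `|ln `|x| | + C.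
  move=> x0 xK.
  have lo := ln_norm_le_half_ln (k.+1%:R^-1) x0.
  have hi : half_ln (k.+1%:R^-1) x <= C by exact: half_ln_le_at1 (tk0 k) (tk1 k) xK.
  rewrite ler_norml; apply/andP; split.
    have := ler_norm (- ln `|x|); rewrite normrN; lra.
  have := normr_ge0 (ln `|x|); lra.
pose g0 (x : R) : R := M * (`|ln `|x| | + C).
have ig0 : leb.-integrable D (EFin \o g0).
  have i1 := integrable_ln_norm K1.
  have i2 := integrable_cst_punctured C K0.
  have i3 := integrableD mD (@integrable_abse _ _ _ leb _ _ i1) i2.
  exact: (integrableZl mD M i3).
have ig : leb.-integrable setT ((EFin \o g0) \_ D) by exact/(integrable_mkcond _ mD).
have ae_n0 (P : R -> Prop) : (forall x, x != 0 -> P x) -> {ae leb, forall x, P x}.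
  move=> Px; exists [set 0]; split => //; first exact: lebesgue_measure_set1.
  by move=> x /=; apply: contra_notP => /eqP/Px.
pose f_ (k : nat) (x : R) := (half_ln (k.+1%:R^-1) x * rho x)%:E.
pose f (x : R) := (ln `|x| * rho x)%:E.
have mf_ k : measurable_fun [set: measurableTypeR R] (f_ k).
  apply/measurable_EFinP; apply: measurable_funM => //; exact: measurable_half_ln.
have mf : measurable_fun [set: measurableTypeR R] f.
  apply/measurable_EFinP; apply: measurable_funM => //.
  by apply: (measurableT_comp (@measurable_ln R)); exact: normr_measurable.
have cv : {ae leb, forall x, setT x -> f_ ^~ x @ \oo --> f x}.
  apply: ae_n0 => x x0 _; apply: cvg_EFin; first exact: nearW.
  by apply: cvgM; [exact: cvg_half_ln|exact: cvg_cst].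
have dom : {ae leb, forall x n, setT x -> (`|f_ n x| <= ((EFin \o g0) \_ D) x)%E}.
  apply: ae_n0 => x x0 k _; rewrite patchE /f_.
  have [->|/rK xK] := eqVneq (rho x) 0.
    rewrite mulr0 /= normr0; case: ifP => // _.
    by rewrite lee_fin mulr_ge0// addr_ge0.
  rewrite mem_set; last by split; [rewrite /= in_itv /= -ler_norml|exact/eqP].
  rewrite /= lee_fin normrM (ger0_norm (density_ge0 rhoP x)) mulrC /g0.
  by apply: ler_pM => //; [exact: density_ge0 rhoP x|exact: hC].
have [intf _ lim] := dominated_convergence measurableT mf_ mf cv ig dom.
rewrite /log_potential.
apply: (@fine_cvg _ _ _ _ (fun k => \int[leb]_x f_ k x)%E).
by rewrite fineK//; exact: integrable_fin_num.
Qed.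

End Limit.

(** * The elastic manifold *)

Section ElasticManifold.
Context {R : realType} {L d : nat}.
Variables (mu0 t0 J : R).

Let N := nsites L d.

Definition base_mx : 'M[R]_N := - (t0 *: laplacian_mx R L d) + mu0%:M.

Lemma site_succK k : cancel (@site_succ L d k) (site_pred k).
Proof.
by move=> x; apply/ffunP => j; rewrite !ffunE; case: eqP => // _; exact: ordSK.
Qed.

Lemma site_predK k : cancel (@site_pred L d k) (site_succ k).
Proof.
by move=> x; apply/ffunP => j; rewrite !ffunE; case: eqP => // _; exact: ord_predK.
Qed.

(** The two neighbour shifts in a direction are inverse to each other, so
transposition exchanges their contributions to the Laplacian. *)
Lemma tr_base_mx : base_mx^T = base_mx.
Proof.
rewrite /base_mx linearD /= linearN linearZ /= tr_scalar_mx; congr (- (_ *: _) + _).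
apply/matrixP => i j; rewrite !mxE /laplacian; apply: eq_bigr => k _.
set x := enum_val i; set y := enum_val j.
rewrite (can2_eq (@site_succK k) (@site_predK k) y).
rewrite (can2_eq (@site_predK k) (@site_succK k) y).
by rewrite !(eq_sym y) [X in X - _]addrC.
Qed.

Lemma dyson_of_solution (u : 'rV[R]_N) (t : R) (m : 'rV[R[i]]_N) :
  dyson_solution t0 mu0 J u (Complex 0 t) m -> dyson base_mx J (external_field u t) m.
Proof.
case=> mE m0; split=> // i.
have := congr1 (fun A : 'M[R[i]]_N => A i i) mE.
rewrite !mxE eqxx !mulr1n => ->; congr (invmx _ i i).
rewrite /shifted /a_mx /base_mx; apply/matrixP => j k; rewrite !mxE.
case: (j == k); rewrite ?mulr0n ?mulr1n; apply/eqP; rewrite eq_complex;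
  rewrite !(ReB, ReD, ImB, ImD, ReMr, ImMr) /=;
  by apply/andP; split; apply/eqP; ring.
Qed.

Variables (m : 'rV[R]_N -> R[i] -> 'rV[R[i]]_N)
  (mu : 'rV[R]_N -> probability (measurableTypeR R) R)
  (rho : 'rV[R]_N -> R -> R).
Hypotheses (L_gt0 : (0 < L)%N) (J_gt0 : 0 < J)
  (mP : forall u z, 0 < Im z -> dyson_solution t0 mu0 J u z (m u z))
  (muP : forall u z, 0 < Im z ->
     stieltjes (mu u) z = (L ^ d)%:R^-1 * \sum_i m u z ord0 i)
  (rhoP : forall u, bounded_compact_density (mu u) (rho u)).

Let dyson_m u t : 0 < t -> dyson base_mx J (external_field u t) (m u (Complex 0 t)).
Proof. by move=> t_gt0; apply: dyson_of_solution; exact: mP. Qed.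

(** Both sides have the same derivative in [t] and the same asymptotics
[N log t + O(1/t)] at infinity. *)
Lemma log_potentialE u (t : R) : 0 < t ->
  N%:R * log_potential (rho u) t = action base_mx J (external_field u t) (m u (Complex 0 t)).
Proof.
move=> t_gt0; apply/eqP; rewrite eq_sym -subr_eq0; apply/eqP.
have NE : (N%:R : R) = (L ^ d)%:R by rewrite /N nsitesE.
have N0 : (N%:R : R) != 0 by rewrite NE pnatr_eq0 -lt0n expn_gt0 L_gt0.
have [C1 [x1 [x1_gt0 h1]]] := action_at_infinity tr_base_mx (fun s s0 => dyson_m u s0).
have [C2 h2] := log_potential_at_infinity (rhoP u).
apply: (@vanishing_of_derive0 _ (fun s => action base_mx J (external_field u s) (m u (Complex 0 s))
   - N%:R * log_potential (rho u) s) (C1 + N%:R * C2) (Num.max 1 x1)) => //.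
- move=> s s_gt0.
  have d1 := is_derive_action_height tr_base_mx J_gt0 s_gt0 (fun s s0 => dyson_m u s0).
  have d2 := is_deriveZ N%:R (is_derive_log_potential (rhoP u) s_gt0).
  have d12 := is_deriveB d1 d2.
  apply: (is_derive_eq d12).
  rewrite -(im_stieltjes (rhoP u))// muP//.
  have -> : ((L ^ d)%:R : R[i])^-1 = (N%:R^-1 : R)%:C.
    by rewrite NE fmorphV rmorph_nat.
  by rewrite ImMr Im_sum /GRing.scale /= mulrA mulfV// mul1r subrr.
- by rewrite lt_max ltr01.
- move=> s; rewrite ge_max => /andP[s1 sx].
  rewrite mulrDl.
  have -> : action base_mx J (external_field u s) (m u (Complex 0 s)) - N%:R * log_potential (rho u) s
    = (action base_mx J (external_field u s) (m u (Complex 0 s)) - N%:R * ln s)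
      - N%:R * (log_potential (rho u) s - ln s) by ring.
  apply: le_trans (ler_normB _ _) _; apply: lerD; first exact: h1.
  by rewrite normrM normr_nat -mulrA ler_wpM2l// h2.
Qed.

Definition smoothed_S (t : R) (u : 'rV[R]_N) : R :=
  log_potential (rho u) t - (\sum_i u ord0 i ^+ 2) / (2 * J ^+ 2 * (L ^ d)%:R).

Lemma smoothed_S_concave t : 0 < t -> concave_function (smoothed_S t).
Proof.
move=> t_gt0 x y s s0 s1.
have N_gt0 : 0 < (L ^ d)%:R :> R by rewrite ltr0n expn_gt0 L_gt0.
have J2_gt0 : 0 < J ^+ 2 by rewrite exprn_gt0.
have SE u : (L ^ d)%:R * smoothed_S t u =
    action base_mx J (external_field u t) (m u (Complex 0 t)) - (\sum_i u 0 i ^+ 2) / (2 * J ^+ 2).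
  have NE : (N%:R : R) = (L ^ d)%:R by rewrite /N nsitesE.
  rewrite -log_potentialE// NE /smoothed_S mulrBr; congr (_ - _).
  by field; rewrite !gt_eqF.
rewrite -(ler_pM2l N_gt0) mulrDr ![(L ^ d)%:R * (_ * _)]mulrCA !SE.
exact: (action_concave tr_base_mx J_gt0 t_gt0 (fun u => dyson_m u t_gt0)).
Qed.

Lemma cvg_smoothed_S u :
  smoothed_S (k.+1%:R^-1) u @[k --> \oo] --> functional_S J rho u.
Proof. by apply: cvgB; [exact: log_potential_cvg (rhoP u)|exact: cvg_cst]. Qed.

Lemma functional_S_concave : concave_function (functional_S J rho).
Proof.
move=> x y s s0 s1.
have lhs : s * smoothed_S (k.+1%:R^-1) x + (1 - s) * smoothed_S (k.+1%:R^-1) y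
    @[k --> \oo] --> s * functional_S J rho x + (1 - s) * functional_S J rho y.
  by apply: cvgD; apply: cvgM; (exact: cvg_cst || exact: cvg_smoothed_S).
apply: (ler_cvg_to lhs); first exact: cvg_smoothed_S.
by apply: nearW => k; apply: smoothed_S_concave; rewrite // invr_gt0.
Qed.

End ElasticManifold.

Theorem proposition4p9 (R : realType) (L d : nat) (mu0 t0 J : R)
    (m_infty : 'rV[R]_(nsites L d) -> R[i] -> 'rV[R[i]]_(nsites L d))
    (mu_infty : 'rV[R]_(nsites L d) -> probability (measurableTypeR R) R)
    (rho_infty : 'rV[R]_(nsites L d) -> R -> R) :
  (0 < L)%N -> (0 < d)%N -> 0 < mu0 -> 0 < t0 -> 0 < J ->
  (forall (u : 'rV[R]_(nsites L d)) (z : R[i]), 0 < complex.Im z ->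
     dyson_solution t0 mu0 J u z (m_infty u z)) ->
  (forall (u : 'rV[R]_(nsites L d)) (z : R[i]), 0 < complex.Im z ->
     stieltjes (mu_infty u) z = (L ^ d)%:R^-1 * \sum_i m_infty u z ord0 i) ->
  (forall u : 'rV[R]_(nsites L d),
     bounded_compact_density (mu_infty u) (rho_infty u)) ->
  concave_function (functional_S J rho_infty).
Proof.
move=> L0 _ _ _ J0 mP muP rhoP.
exact: functional_S_concave L0 J0 mP muP rhoP.
Qed.
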